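(* Let $W,V:(0,\infty)^2\to[0,\infty)$ be symmetric measurable functions with $0\le W(x,y)\le 1$ and $0\le V(x,y)\le \frac{1}{x+y}$ for all $x,y>0$, and for $\varepsilon>0$ set $K_\varepsilon=2+\varepsilon W$ and $F_\varepsilon=2+\varepsilon V$. Let $\rho>0$ be given. Then there exists $\varepsilon_*>0$ such that for each $\varepsilon\in(0,\varepsilon_* )$ there exists at most one equilibrium (stationary solution) $Q_\varepsilon\in L^1_1$ of the coagulation-fragmentation equation with kernels $K_\varepsilon,F_\varepsilon$ with total mass $\int_0^\infty xQ_\varepsilon(x)\,dx=\rho$.
   Context: For $\alpha\ge 0$, $L^1_\alpha$ is the space of measurable $f$ on $(0,\infty)$ with $\|f\|_{L^1_\alpha}=\int_0^\infty(1+x)^\alpha|f(x)|\,dx<\infty$. For symmetric measurable kernels $K,F:(0,\infty)^2\to[0,\infty)$ define $$\mathcal C_K(f,g)(x)=\tfrac12\int_0^xK(x-y,y)f(x-y)g(y)\,dy-\tfrac12f(x)\int_0^\infty K(x,y)g(y)\,dy-\tfrac12g(x)\int_0^\infty K(x,y)f(y)\,dy,$$ $$\mathcal F_F(f)(x)=-\tfrac12 f(x)\int_0^xF(y,x-y)\,dy+\int_0^\infty F(x,y)f(x+y)\,dy.$$ The coagulation-fragmentation equation with kernels $K,F$ is $\partial_tf_t=\mathcal C_K(f_t,f_t)+\mathcal F_F(f_t)$. An equilibrium (stationary solution) is a non-negative time-independent solution, i.e. a non-negative $Q\in L^1_1$ with $\mathcal C_K(Q,Q)+\mathcal F_F(Q)=0$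 a.e. on $(0,\infty)$. *)

(* Defs.v *)
From HB Require Import structures.
From mathcomp Require Import all_boot all_order all_algebra.
From mathcomp Require Import all_classical all_reals all_analysis.

Set Implicit Arguments.
Unset Strict Implicit.
Unset Printing Implicit Defensive.

Import Order.TTheory GRing.Theory Num.Theory.
Import numFieldNormedType.Exports.

Local Open Scope classical_set_scope.
Local Open Scope ring_scope.

(* Functions on (0, oo) and kernels on (0, oo)^2 are represented by total
   functions on R and R * R; their values outside these sets are never used. *)
Definition halfline (R : realType) : set R := [set x | 0 < x].
Arguments halfline : clear implicits.

(* Measurability is Borel measurability, which loses no class modulo
   a.e. equality. *)
Definition L1_weighted (R : realType) (alpha : R) (f : R -> R) : Prop :=
  measurable_fun (halfline R) f /\
  (\int[lebesgue_measure]_(x in halfline R)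
     ((1 + x) `^ alpha * `|f x|)%:E < +oo)%E.

Definition sym_kernel (R : realType) (K : R -> R -> R) : Prop :=
  [/\ measurable_fun (halfline R `*` halfline R) (fun p : R * R => K p.1 p.2),
      forall x y, 0 < x -> 0 < y -> K x y = K y x &
      forall x y, 0 < x -> 0 < y -> 0 <= K x y].

(* The integrals below are real valued, hence 0 when infinite. For f, g in
   L^1_1, K bounded and F <= c + c / (x + y), all of them converge absolutely
   for almost every x > 0, so this convention does not affect the equations
   (which are required only a.e.). *)
Definition coag (R : realType) (K : R -> R -> R) (f g : R -> R) (x : R) : R :=
  2^-1 * (\int[lebesgue_measure]_(y in `]0%R, x[)
            (K (x - y) y * f (x - y) * g y))%R
  - 2^-1 * f x * (\int[lebesgue_measure]_(y in halfline R) (K x y * g y))%R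
  - 2^-1 * g x * (\int[lebesgue_measure]_(y in halfline R) (K x y * f y))%R.

Definition frag (R : realType) (F : R -> R -> R) (f : R -> R) (x : R) : R :=
  - (2^-1 * f x * (\int[lebesgue_measure]_(y in `]0%R, x[) F y (x - y))%R)
  + (\int[lebesgue_measure]_(y in halfline R) (F x y * f (x + y)))%R.

Definition equilibrium (R : realType) (K F : R -> R -> R) (Q : R -> R) : Prop :=
  [/\ L1_weighted 1 Q,
      {ae lebesgue_measure, forall x : R, 0 < x -> 0 <= Q x} &
      {ae lebesgue_measure, forall x : R, 0 < x ->
         coag K Q Q x + frag F Q x = 0}].

Definition mass (R : realType) (Q : R -> R) : R :=
  (\int[lebesgue_measure]_(x in halfline R) (x * Q x))%R.

(* Main.v *)
(* Let [S = Q1 + Q2] and [h = Q1 - Q2], so that [int x h = 0]. Since coagulation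
   is a symmetric bilinear form, subtracting the two equations gives
     S * h - h int S - S int h - x h + 2 int_x^oo h = O(kappa),
   where [kappa = C eps ||h||_(L^1_1)] comes from W and V. The left-hand side
   controls [h] with a constant depending only on [rho], without knowing that
   [S] is close to the explicit equilibrium of the unperturbed equation.
   Indeed, let [H a = int_a^oo h] and [j a = int min(a, x) h = - int_a^oo H].
   The test functions min(a, .) and 1_(x > a) give
     (int S + a) j(a) = (S * j)(a) + O(kappa min(1, a)),
     (int S + a) H(a) = (S * H)(a) - j(a) + O(kappa / (1 + a)).
   The first equation gives |j| <= kappa by a maximum principle, hence
   j(a) = O(kappa / (1 + a)); the second one, integrated against
   sgn H / (1 + a), gives ||H||_(L^1) = O(kappa); finally the test function
   (1 + 1 / (1 + x)) sgn h gives ||h||_(L^1_1) = O(kappa), so that h = 0 for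
   small eps. The last two steps use the decrease of 1 / (1 + x), through a
   lower bound on int x / (1 + x) S which rules out that the mass escapes to
   infinity, and the finite bound int S <= 2 (rho + 1). *)

Require Import Defs.
From HB Require Import structures.
From mathcomp Require Import all_boot all_order all_algebra.
From mathcomp Require Import all_classical all_reals all_analysis.
From mathcomp Require Import measurable_realfun.
From mathcomp Require Import ring lra.

Set Implicit Arguments.
Unset Strict Implicit.
Unset Printing Implicit Defensive.

Import Order.TTheory GRing.Theory Num.Theory.
Import numFieldNormedType.Exports.

Local Open Scope classical_set_scope.
Local Open Scope ring_scope.

(** * Real-valued integrals *)

(** Testing with [sgn h] alone does not close, for two reasons. In absolute value the fragmentation
    gain may reach [2 int x |h|], twice the fragmentation loss, so the cancellations inside the tail
    integral [H] are needed before [h] can be estimated. The equation for [H] still has a source,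
    [- j]; for [j] the zero mass of [h] turns the whole fragmentation term into the damping
    [- a * j a], and the hierarchy stops there. Moreover coagulation is only neutral: convolution
    with [S] has norm [int S], exactly its loss rate, while the damping [a] degenerates at 0. For
    [j] this is repaired by [|j a| <= a * int |h|]; for [H] and [h] by the strict gap between the
    weight at [u + t] and the weight at [t]. Functions on the half-line are extended by 0 to the
    whole line, so that translations, shears and Fubini apply without conditions on domains. *)

Section real_integrals.
Context d (T : measurableType d) (R : realType).
Variable m : {measure set T -> \bar R}.
Implicit Types f g : T -> R.

Definition Rintegrable f := m.-integrable setT (EFin \o f).

Definition Int f : R := (\int[m]_x f x)%R.

Lemma Rintegrable_measurable f : Rintegrable f -> measurable_fun setT f.
Proof. by move=> /measurable_int/measurable_EFinP. Qed.

Lemma RintegrableD f g : Rintegrable f -> Rintegrable g ->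
  Rintegrable (fun x => f x + g x).
Proof. by move=> sf sg; exact: (integrableD measurableT sf sg). Qed.

Lemma RintegrableN f : Rintegrable f -> Rintegrable (fun x => - f x).
Proof. by move=> sf; exact: (integrableN sf). Qed.

Lemma RintegrableB f g : Rintegrable f -> Rintegrable g ->
  Rintegrable (fun x => f x - g x).
Proof. by move=> sf sg; exact/RintegrableD/RintegrableN. Qed.

Lemma RintegrableZ (k : R) f : Rintegrable f -> Rintegrable (fun x => k * f x).
Proof. by move=> sf; exact: (integrableZl measurableT k sf). Qed.

Lemma Rintegrable_norm f : Rintegrable f -> Rintegrable (fun x => `|f x|).
Proof. by move=> sf; exact: (integrable_norm sf). Qed.

Lemma Rintegrable_le f g : measurable_fun setT f -> (forall x, `|f x| <= g x) ->
  Rintegrable g -> Rintegrable f.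
Proof.
move=> mf fg sg; apply: (le_integrable measurableT _ _ sg).
  exact/measurable_EFinP.
by move=> x _ /=; rewrite lee_fin (le_trans (fg x)) ?ler_norm.
Qed.

Lemma Rintegrable_bounded f g (M : R) : measurable_fun setT f ->
  (forall x, `|f x| <= M) -> Rintegrable g -> Rintegrable (fun x => f x * g x).
Proof.
move=> mf fM sg; apply: (@Rintegrable_le _ (fun x => M * `|g x|)).
- by apply: measurable_funM => //; exact: Rintegrable_measurable.
- by move=> x; rewrite normrM ler_wpM2r.
- exact/RintegrableZ/Rintegrable_norm.
Qed.

Lemma eq_Int f g : f =1 g -> Int f = Int g.
Proof. by move=> /funext ->. Qed.

Lemma Int0 : Int (fun=> 0) = 0.
Proof. by rewrite /Int /Rintegral integral0. Qed.

Lemma IntD f g : Rintegrable f -> Rintegrable g -> Int (fun x => f x + g x) =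
  Int f + Int g.
Proof. by move=> sf sg; exact: RintegralD. Qed.

Lemma IntB f g : Rintegrable f -> Rintegrable g -> Int (fun x => f x - g x) =
  Int f - Int g.
Proof. by move=> sf sg; exact: RintegralB. Qed.

Lemma IntZ (k : R) f : Rintegrable f -> Int (fun x => k * f x) = k * Int f.
Proof. by move=> sf; exact: RintegralZl. Qed.

Lemma IntN f : Rintegrable f -> Int (fun x => - f x) = - Int f.
Proof.
move=> sf; rewrite -mulN1r -IntZ//; apply: eq_Int => x; by rewrite mulN1r.
Qed.

Lemma Int_ge0 f : (forall x, 0 <= f x) -> 0 <= Int f.
Proof. by move=> f0; apply: Rintegral_ge0. Qed.

Lemma le_Int f g : Rintegrable f -> Rintegrable g -> (forall x, f x <= g x) ->
  Int f <= Int g.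
Proof. by move=> sf sg fg; exact: le_Rintegral. Qed.

Lemma norm_Int f g : Rintegrable f -> Rintegrable g ->
  (forall x, `|f x| <= g x) ->
  `|Int f| <= Int g.
Proof.
move=> sf sg fg; apply: (le_trans (le_normr_Rintegral measurableT sf)).
by apply: le_Int => //; exact: Rintegrable_norm.
Qed.

Lemma Int_EFin f : Rintegrable f -> ((Int f)%:E = \int[m]_x (f x)%:E)%E.
Proof. by move=> sf; rewrite /Int /Rintegral fineK//;
  exact: integrable_fin_num. Qed.

Lemma ae_eq_Int f g : measurable_fun setT f -> measurable_fun setT g ->
  {ae m, forall x, f x = g x} -> Int f = Int g.
Proof.
move=> mf mg fg; congr fine; apply: ae_eq_integral => //.
- exact/measurable_EFinP.
- exact/measurable_EFinP.
- by apply: filterS fg => x /= fg _; rewrite fg.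
Qed.

Lemma ae_mono (P Q : T -> Prop) : {ae m, forall x, P x} ->
  (forall x, P x -> Q x) -> {ae m, forall x, Q x}.
Proof. by move=> aeP PQ; apply: filterS aeP. Qed.

Lemma ae_mono3 (P Q P' S : T -> Prop) : {ae m, forall x, P x} ->
  {ae m, forall x, Q x} -> {ae m, forall x, P' x} ->
  (forall x, P x -> Q x -> P' x -> S x) -> {ae m, forall x, S x}.
Proof. by move=> aeP aeQ aeP' h; apply: filterS3 aeP aeQ aeP'. Qed.

Lemma Int_norm_eq0 f : Rintegrable f -> Int (fun x => `|f x|) = 0 ->
  {ae m, forall x, f x = 0}.
Proof.
move=> sf f0.
have h : (\int[m]_x `|(EFin \o f) x| = 0)%E.
  transitivity ((Int (fun x => `|f x|))%:E); last by rewrite f0.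
  by rewrite Int_EFin//; exact: Rintegrable_norm.
have [+ _] := ae_eq_integral_abs m measurableT (measurable_int _ sf).
by move=> /(_ h); apply: filterS => x /= /(_ I) [].
Qed.

End real_integrals.

(** * Fubini, translations and shears of the plane *)

Section plane.
Variable R : realType.
Local Notation mu := (@lebesgue_measure R).
Local Notation mu2 := (mu \x mu)%E.
Implicit Types (f g : R -> R) (k : R * R -> R).

(** The pushforward of Lebesgue measure under the translation agrees with it on half-open intervals,
    hence everywhere by uniqueness. The signed case follows from the positive and negative parts. *)
Lemma integral_shift (f : R -> \bar R) (a : R) : measurable_fun setT f ->
  (\int[mu]_x f (x + a)%R = \int[mu]_x f x)%E.
Proof.
move=> mf.
have ma : measurable_fun [set: measurableTypeR R]
    (fun x : measurableTypeR R => x + a : measurableTypeR R).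
  by apply: measurable_funD.
pose ma_mixin := isMeasurableFun.Build _ _ _ _ _ ma.
pose phi : {mfun measurableTypeR R >-> measurableTypeR R} :=
  HB.pack (fun x : R => x + a) ma_mixin.
have muE A : measurable A -> pushforward mu phi A = mu A.
  move=> mA; apply/esym.
  apply: (lebesgue_measure_unique (mu := pushforward mu phi)) => //.
  move=> X [[b c] _ <-].
  have E : phi @^-1` `]b, c]%classic = `]b - a, c - a]%classic.
    by apply/seteqP; split => x /=; rewrite !in_itv/= ltrBlDr lerBrDr.
  transitivity (mu `]b - a, c - a]%classic); last by rewrite -E.
  rewrite !lebesgue_measure_itv/= !lte_fin ltrD2r.
  by case: ifPn => // _; rewrite -!EFinD; congr (_%:E); ring.
have ge0 (g : R -> \bar R) : measurable_fun setT g -> (forall x, 0 <= g x)%E ->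
    (\int[mu]_x g (x + a)%R = \int[mu]_x g x)%E.
  move=> mg g0.
  rewrite -[RHS](@eq_measure_integral _ _ _ _ mu (pushforward mu phi))//;
    last first.
    by move=> A mA _; exact: muE.
  by rewrite ge0_integral_pushforward.
rewrite integralE [RHS]integralE.
have mp : measurable_fun setT (f^\+)%E by exact: measurable_funepos.
have mn : measurable_fun setT (f^\-)%E by exact: measurable_funeneg.
have -> : (\int[mu]_x f^\+ x = \int[mu]_x f^\+ (x + a)%R)%E by rewrite ge0.
have -> : (\int[mu]_x f^\- x = \int[mu]_x f^\- (x + a)%R)%E by rewrite ge0.
by congr (_ - _)%E; apply: eq_integral => x _; rewrite ?funeposE ?funenegE.
Qed.


Local Notation I1 := (Int mu).
Local Notation I2 := (Int mu2).

Lemma I1_shift f (a : R) : measurable_fun setT f ->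
  I1 (fun x => f (x + a)) = I1 f.
Proof.
by move=> mf; congr fine; apply: (integral_shift (f := EFin \o f));
  exact/measurable_EFinP.
Qed.

(** Only almost every section of [k] is integrable; at the other points the real inner integral
    takes a default value, so it matches the extended-valued marginal only almost everywhere. *)
Lemma Rintegrable_iter1 k : Rintegrable mu2 k -> Rintegrable mu (fun x => I1
  (fun y => k (x, y))).
Proof.
move=> sk; have ae1 := ae_integrable1 sk.
have iF := integrable_fubini_F sk.
have mF : measurable_fun setT (fun x => I1 (fun y => k (x, y))).
  by apply: (measurableT_comp (fine_measurable measurableT) _);
    exact: measurable_int iF.
apply/integrableP; split; first exact/measurable_EFinP.
have /integrableP[_] := iF; apply: le_lt_trans.
rewrite le_eqVlt; apply/orP; left; apply/eqP/ae_eq_integral => //.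
- by do 2 apply: measurableT_comp => //.
- by apply: measurableT_comp => //; exact: measurable_int iF.
- by apply: filterS ae1 => x sx _; congr abse; exact: Int_EFin.
Qed.

Lemma I2_iter1 k : Rintegrable mu2 k -> I2 k =
  I1 (fun x => I1 (fun y => k (x, y))).
Proof.
move=> sk; have ae1 := ae_integrable1 sk.
have iF := integrable_fubini_F sk.
congr fine; rewrite -integral12_prod_meas1//.
apply: ae_eq_integral => //.
- exact: measurable_int iF.
- by apply/measurable_EFinP; exact: Rintegrable_measurable (Rintegrable_iter1
  sk).
- by apply: filterS ae1 => x sx _; exact/esym/Int_EFin.
Qed.


Lemma measurable_comp_swap k : measurable_fun setT k -> measurable_fun setT
  (fun p => k (p.2, p.1)).
Proof.
move=> mk; apply: (measurableT_comp mk).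
by apply: measurable_fun_pair; [exact: measurable_snd|exact: measurable_fst].
Qed.

Lemma Rintegrable2_swap k : Rintegrable mu2 k -> Rintegrable mu2
  (fun p => k (p.2, p.1)).
Proof.
move=> sk; have mk := Rintegrable_measurable sk.
apply/integrable12ltyP; first by apply/measurable_EFinP;
  exact: measurable_comp_swap.
have mEk : measurable_fun setT (EFin \o k) by exact/measurable_EFinP.
exact: (iffLR (@integrable21ltyP _ _ _ _ _ mu mu _ mEk) sk).
Qed.

Lemma I2_swap k : Rintegrable mu2 k -> I2 (fun p => k (p.2, p.1)) = I2 k.
Proof.
move=> sk; have ss := Rintegrable2_swap sk; congr fine.
by rewrite -[LHS]integral12_prod_meas1//= -integral21_prod_meas1.
Qed.

Lemma I2_iter2 k : Rintegrable mu2 k -> I2 k =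
  I1 (fun y => I1 (fun x => k (x, y))).
Proof. by move=> sk; rewrite -I2_swap// I2_iter1//; exact: Rintegrable2_swap.
Qed.

Lemma Rintegrable_iter2 k : Rintegrable mu2 k -> Rintegrable mu (fun y => I1
  (fun x => k (x, y))).
Proof. by move=> /Rintegrable2_swap/Rintegrable_iter1. Qed.

(** Every section is required to be integrable because a divergent inner integral would count as 0
    and escape the last premise. *)
Lemma tonelli_summ1 k : measurable_fun setT k ->
  (forall x, Rintegrable mu (fun y => k (x, y))) ->
  Rintegrable mu (fun x => I1 (fun y => `|k (x, y)|)) -> Rintegrable mu2 k.
Proof.
move=> mk sk sI; apply/integrable12ltyP; first exact/measurable_EFinP.
have /integrableP[_] := sI; apply: le_lt_trans.
apply: ge0_le_integral => //.
- by move=> x _; exact: integral_ge0.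
- apply: (measurable_fun_fubini_tonelli_F (m2 := mu) (abse \o (EFin \o k))) =>
  //=.
  by apply: measurableT_comp => //; exact/measurable_EFinP.
- by apply: measurableT_comp => //; exact: measurable_int sI.
- move=> x _ /=; rewrite ger0_norm ?Int_ge0// Int_EFin//.
  exact: Rintegrable_norm.
Qed.

Lemma tonelli_summ2 k : measurable_fun setT k ->
  (forall y, Rintegrable mu (fun x => k (x, y))) ->
  Rintegrable mu (fun y => I1 (fun x => `|k (x, y)|)) -> Rintegrable mu2 k.
Proof.
move=> mk sk sI; rewrite (_ : k = (fun p => (fun q => k (q.2, q.1))
  (p.2, p.1))).
  by apply: (@Rintegrable2_swap (fun q => k (q.2, q.1)));
    apply: tonelli_summ1 => //; exact: measurable_comp_swap.
by apply/funext => -[].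
Qed.

Lemma measurable_comp_shear (c : R) k : measurable_fun setT k ->
  measurable_fun setT (fun p : R * R => k (p.1, p.2 + c * p.1)).
Proof.
move=> mk; apply: (measurableT_comp mk).
apply/measurable_fun_pair; first exact: measurable_fst.
apply: measurable_funD; first exact: measurable_snd.
by apply: measurable_funM => //; exact: measurable_fst.
Qed.

(** On each line of constant [x] the shear is a translation. Together with the swap, the values
    [c = 1] and [c = -1] provide every change of variables used below. *)
Lemma Rintegrable2_shear (c : R) k : Rintegrable mu2 k ->
  Rintegrable mu2 (fun p : R * R => k (p.1, p.2 + c * p.1)).
Proof.
move=> sk; have mk := Rintegrable_measurable sk.
apply/integrable12ltyP; first by apply/measurable_EFinP;
  exact: measurable_comp_shear.
have mEk : measurable_fun setT (EFin \o k) by exact/measurable_EFinP.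
move: (iffLR (@integrable12ltyP _ _ _ _ _ mu mu _ mEk) sk).
apply: le_lt_trans; rewrite le_eqVlt; apply/orP; left; apply/eqP.
apply: eq_integral => x _.
have mkx : measurable_fun setT (fun y : R => `|(k (x, y))%:E|%E).
  apply: measurableT_comp => //; apply/measurable_EFinP.
  exact: measurable_fun_pair2.
exact: (integral_shift (c * x) mkx).
Qed.

Lemma I2_shear (c : R) k : Rintegrable mu2 k ->
  I2 (fun p : R * R => k (p.1, p.2 + c * p.1)) = I2 k.
Proof.
move=> sk; have ss := Rintegrable2_shear c sk; rewrite I2_iter1// I2_iter1//.
apply: eq_Int => x /=.
have mkx : measurable_fun setT (fun y : R => k (x, y)).
  by apply: measurable_fun_pair2; exact: Rintegrable_measurable sk.
exact: (I1_shift (c * x) mkx).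
Qed.

End plane.

(** * Product kernels and the fragmentation triangle *)

Section kernels.
Variable R : realType.
Local Notation mu := (@lebesgue_measure R).
Local Notation mu2 := (mu \x mu)%E.
Local Notation I1 := (Int mu).
Local Notation I2 := (Int mu2).
Implicit Types (f g phi : R -> R) (k : R * R -> R).

Lemma measurable_ltr_nat d (T : measurableType d) (f g : T -> R) :
  measurable_fun setT f -> measurable_fun setT g ->
  measurable_fun setT (fun x => (f x < g x)%R%:R : R).
Proof.
move=> mf mg.
rewrite (_ : (fun _ => _) = (fun x => if f x < g x then 1 else 0)).
  by apply: measurable_fun_ifT => //; exact: measurable_fun_ltr.
by apply/funext => x; case: ifP.
Qed.

Lemma measurable_comp_fst f : measurable_fun setT f ->
  measurable_fun setT (fun p : R * R => f p.1).
Proof. by move=> mf; exact: measurableT_comp. Qed.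

Lemma measurable_comp_snd f : measurable_fun setT f ->
  measurable_fun setT (fun p : R * R => f p.2).
Proof. by move=> mf; exact: measurableT_comp. Qed.

Lemma measurable_comp_add f : measurable_fun setT f ->
  measurable_fun setT (fun p : R * R => f (p.1 + p.2)).
Proof.
move=> mf; apply: (measurableT_comp mf).
by apply: measurable_funD; [exact: measurable_fst|exact: measurable_snd].
Qed.

(* Indicator of [0 < y < v] at [p = (y, v)]: the fragments y of a cluster v. *)
Definition tri (p : R * R) : R := (0 < p.1)%R%:R * (p.1 < p.2)%R%:R.

Lemma measurable_tri : measurable_fun setT tri.
Proof.
apply: measurable_funM; apply: measurable_ltr_nat => //.
Qed.

Lemma tri_ge0 p : 0 <= tri p.
Proof. by rewrite mulr_ge0. Qed.

Lemma Rintegrable2_prod f g : Rintegrable mu f -> Rintegrable mu g ->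
  Rintegrable mu2 (fun p => f p.1 * g p.2).
Proof.
move=> sf sg; apply: tonelli_summ1 => /=.
- by apply: measurable_funM;
  [apply: measurable_comp_fst (Rintegrable_measurable sf)|apply:
  measurable_comp_snd (Rintegrable_measurable sg)].
- by move=> x; exact: RintegrableZ.
- rewrite (_ : (fun _ => _) = (fun x => I1 (fun y => `|g y|) * `|f x|)).
    exact: (RintegrableZ _ (Rintegrable_norm sf)).
  apply/funext => x; rewrite mulrC -(IntZ _ (Rintegrable_norm sg)).
  by apply: eq_Int => y; rewrite normrM.
Qed.

Lemma I2_prod f g : Rintegrable mu f -> Rintegrable mu g ->
  I2 (fun p => f p.1 * g p.2) = I1 f * I1 g.
Proof.
move=> sf sg; rewrite I2_iter1/=; last exact: Rintegrable2_prod.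
rewrite mulrC -IntZ//; apply: eq_Int => x; rewrite IntZ//; exact: mulrC.
Qed.

Lemma Rintegrable2_bprod (B : R * R -> R) (M : R) f g : measurable_fun setT B ->
  (forall p, `|B p| <= M) -> Rintegrable mu f -> Rintegrable mu g ->
  Rintegrable mu2 (fun p => B p * (f p.1 * g p.2)).
Proof. by move=> mB BM sf sg; exact: (Rintegrable_bounded (m := mu2) mB BM
  (Rintegrable2_prod sf sg)). Qed.

Lemma indic_itvoo (v : R) :
  (fun y => tri (y, v)) = \1_(`]0, v[%classic : set R).
Proof.
apply/funext => y; rewrite indicE /tri/= mem_setE in_itv/=.
by case: (0 < y); case: (y < v); rewrite ?(mulr0,mul0r,mulr1).
Qed.

Lemma Rintegrable_tri1 (v : R) : Rintegrable mu (fun y => tri (y, v)).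
Proof. by rewrite indic_itvoo; exact: integrable_indic_itv. Qed.

Lemma I1_tri (v : R) : 0 <= v -> I1 (fun y => tri (y, v)) = v.
Proof.
move=> v0; rewrite indic_itvoo /Int /Rintegral.
rewrite (integral_indic mu measurableT)//= setIT lebesgue_measure_itv/= lte_fin.
by case: ltP => [_|v0']; rewrite ?sube0//=; apply/eqP; rewrite eq_le v0 v0'.
Qed.

Lemma tri_le0 (y v : R) : v <= 0 -> tri (y, v) = 0.
Proof.
move=> v0; rewrite /tri/=; case: ltP => [y0|]; rewrite ?mul0r// ltNge.
by rewrite (le_trans v0 (ltW y0)) mulr0.
Qed.

(** Integrating over the fragment first yields the length [v] of []0, v[], whence the first moment
    in the premise. *)
Lemma Rintegrable2_tri f : measurable_fun setT f ->
  Rintegrable mu (fun v => v * f v) -> Rintegrable mu2 (fun p => tri p * f p.2).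
Proof.
move=> mf sf; apply: tonelli_summ2 => /=.
- by apply: measurable_funM; [exact: measurable_tri|exact: measurable_comp_snd].
- move=> y; rewrite (_ : (fun _ => _) = (fun x => f y * tri (x, y))).
    exact: (RintegrableZ _ (Rintegrable_tri1 y)).
  by apply/funext => x; rewrite mulrC.
- have E v : I1 (fun x => `|tri (x, v) * f v|) = (0 < v)%R%:R * `|v * f v|.
    rewrite (@eq_Int _ _ _ mu _ (fun x => `|f v| * tri (x, v))); last first.
      by move=> x; rewrite normrM (ger0_norm (tri_ge0 _)) mulrC.
    rewrite IntZ; last exact: Rintegrable_tri1.
    case: ltP => v0; first by rewrite I1_tri ?ltW// normrM (gtr0_norm v0) mul1r
      mulrC.
    rewrite mul0r (@eq_Int _ _ _ mu _ (fun=> 0)) ?Int0 ?mulr0// => x.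
    by rewrite tri_le0.
  apply: (@Rintegrable_le _ _ _ mu _ (fun v => `|v * f v|)).
  + rewrite (_ : (fun _ => _) = (fun v => (0 < v)%R%:R * `|v * f v|));
    last exact/funext.
    apply: measurable_funM; first exact: measurable_ltr_nat.
    by apply: measurableT_comp => //; exact: measurable_funM.
  + move=> v; rewrite E normrM normr_id ger0_norm//.
    by case: (0 < v); rewrite ?mul1r// mul0r.
  + exact: Rintegrable_norm.
Qed.

Lemma I2_tri f : measurable_fun setT f ->
  Rintegrable mu (fun v => v * f v) -> (forall v, v <= 0 -> f v = 0) ->
  I2 (fun p => tri p * f p.2) = I1 (fun v => v * f v).
Proof.
move=> mf sf f0; rewrite I2_iter2; last exact: Rintegrable2_tri.
apply: eq_Int => v /=.
rewrite (@eq_Int _ _ _ mu _ (fun x => f v * tri (x, v))); last first.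
  by move=> x; rewrite mulrC.
rewrite IntZ; last exact: Rintegrable_tri1.
by have [v0|v0] :=
  leP v 0; [rewrite f0// mul0r mulr0|rewrite I1_tri ?ltW// mulrC].
Qed.

Lemma frag_bounded phi (M : R) p : (forall x, `|phi x| <= M) ->
  `|phi p.1 - phi p.2 / 2| <= M + M :> R.
Proof.
move=> phiM; rewrite (le_trans (ler_normB _ _))// lerD//
  (le_trans _ (phiM p.2))//.
by rewrite normrM ler_piMr// ger0_norm ?invr_ge0//; lra.
Qed.

Lemma measurable_frag_test phi : measurable_fun setT phi ->
  measurable_fun setT (fun p : R * R => phi p.1 - phi p.2 / 2).
Proof.
move=> mphi; apply: measurable_funB; first exact: measurable_comp_fst.
by apply: measurable_funM => //; exact: measurable_comp_snd.
Qed.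

Lemma coag_bounded phi (M : R) p : (forall x, `|phi x| <= M) ->
  `|phi (p.1 + p.2) - phi p.1 - phi p.2| <= M + M + M :> R.
Proof.
move=> phiM.
by rewrite (le_trans (ler_normB _ _))// lerD// (le_trans (ler_normB _ _))//
  lerD.
Qed.

Lemma measurable_coag_test phi : measurable_fun setT phi ->
  measurable_fun setT (fun p : R * R => phi (p.1 + p.2) - phi p.1 - phi p.2).
Proof.
move=> mphi; apply: measurable_funB; last exact: measurable_comp_snd.
by apply: measurable_funB; [exact: measurable_comp_add|exact:
  measurable_comp_fst].
Qed.

End kernels.

(** * Weak formulation *)

Section weak_form.
Variable R : realType.
Local Notation mu := (@lebesgue_measure R).
Local Notation mu2 := (mu \x mu)%E.
Local Notation I1 := (Int mu).
Local Notation I2 := (Int mu2).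
Implicit Types (f g phi q : R -> R) (k w v : R * R -> R).

Record kernel_bounds w v : Prop := {
  kb_mw : measurable_fun setT w ;
  kb_mv : measurable_fun setT v ;
  kb_w : forall p, 0 <= w p <= 1 ;
  kb_v : forall p, 0 <= v p <= tri p / p.2 }.

Record profile (rho : R) q : Prop := {
  pf_meas : measurable_fun setT q ;
  pf_ge0 : forall x, 0 <= q x ;
  pf_le0 : forall x, x <= 0 -> q x = 0 ;
  pf_summ : Rintegrable mu q ;
  pf_summx : Rintegrable mu (fun x => x * q x) ;
  pf_mass : I1 (fun x => x * q x) = rho }.

(* [p] is the pair of merging clusters in the first integral, but the pair
   (fragment, parent) in the second one. With [K = 2 + eps w], the factor
   [1 + eps / 2 * w] is [K / 2]; [v] is the fragmentation perturbation V in the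
   coordinates (fragment, parent), extended by 0. *)
Definition weak_solution w v (eps : R) q := forall phi (M : R),
  measurable_fun setT phi -> (forall x, `|phi x| <= M) ->
  I2 (fun p => (phi (p.1 + p.2) - phi p.1 - phi p.2) *
               ((1 + eps / 2 * w p) * (q p.1 * q p.2))) +
  I2 (fun p => (phi p.1 - phi p.2 / 2) * ((2 * tri p + eps * v p) * q p.2)) = 0.

Lemma I2_mul_fst phi (M : R) k : measurable_fun setT phi ->
  (forall x, `|phi x| <= M) -> Rintegrable mu2 k ->
  I1 (fun x => phi x * I1 (fun y => k (x, y))) = I2 (fun p => phi p.1 * k p).
Proof.
move=> mphi phiM sk.
have sphik : Rintegrable mu2 (fun p => phi p.1 * k p).
  exact: (Rintegrable_bounded (m := mu2) (measurable_comp_fst mphi)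
    (fun p => phiM p.1) sk).
rewrite I2_iter1//; apply: ae_eq_Int => /=.
- exact: (measurable_funM mphi (Rintegrable_measurable (Rintegrable_iter1 sk))).
- exact: (Rintegrable_measurable (Rintegrable_iter1 sphik)).
- have := ae_integrable1 sk; apply: filterS => x /= sx.
  by rewrite IntZ.
Qed.

(** Serves to replace an equilibrium, nonnegative only almost everywhere, by its absolute value.
    Iterated integrals treat the null set one variable at a time. *)
Lemma ae_eq_I2_prod k f g : measurable_fun setT f -> measurable_fun setT g ->
  {ae mu, forall x, f x = g x} ->
  Rintegrable mu2 (fun p => k p * (f p.1 * f p.2)) ->
  Rintegrable mu2 (fun p => k p * (g p.1 * g p.2)) ->
  measurable_fun setT k ->
  I2 (fun p => k p * (f p.1 * f p.2)) = I2 (fun p => k p * (g p.1 * g p.2)).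
Proof.
move=> mf mg fg sf sg mk; rewrite !I2_iter1//; apply: ae_eq_Int => /=.
- exact: (Rintegrable_measurable (Rintegrable_iter1 sf)).
- exact: (Rintegrable_measurable (Rintegrable_iter1 sg)).
- apply: (ae_mono (m := mu) fg) => x fgx.

  apply: ae_eq_Int => /=.
  + apply: measurable_funM; first exact: measurable_fun_pair2.
    exact: measurable_funM.
  + apply: measurable_funM; first exact: measurable_fun_pair2.
    exact: measurable_funM.
  + by apply: (ae_mono (m := mu) fg) => y fgy; rewrite fgx fgy.
Qed.

Lemma ae_eq_I2_snd k f g : measurable_fun setT f -> measurable_fun setT g ->
  {ae mu, forall x, f x = g x} ->
  Rintegrable mu2 (fun p => k p * f p.2) ->
  Rintegrable mu2 (fun p => k p * g p.2) ->
  measurable_fun setT k ->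
  I2 (fun p => k p * f p.2) = I2 (fun p => k p * g p.2).
Proof.
move=> mf mg fg sf sg mk; rewrite !I2_iter1//; apply: ae_eq_Int => /=.
- exact: (Rintegrable_measurable (Rintegrable_iter1 sf)).
- exact: (Rintegrable_measurable (Rintegrable_iter1 sg)).
- apply: aeW => x; apply: ae_eq_Int => /=.
  + by apply: measurable_funM => //; exact: measurable_fun_pair2.
  + by apply: measurable_funM => //; exact: measurable_fun_pair2.
  + by apply: (ae_mono (m := mu) fg) => y fgy; rewrite fgy.
Qed.

Lemma measurable_inv : measurable_fun setT (fun x : R => x^-1).
Proof.
rewrite -(setvU [set (0 : R)]); apply/measurable_funU => //.
  exact: measurableC.
split; last exact: measurable_fun_set1.
apply: open_continuous_measurable_fun => [|x].
  apply: closed_openC; apply: accessible_closed_set1.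
  exact: hausdorff_accessible (@Rhausdorff R).
by rewrite inE/= => /eqP x0; exact: inv_continuous.
Qed.

Section kernel_integrable.
Variables (w v : R * R -> R) (eps : R).
Hypotheses (kb : kernel_bounds w v) (eps0 : 0 <= eps).

Lemma Rintegrable2_v f : measurable_fun setT f -> Rintegrable mu f ->
  Rintegrable mu2 (fun p => v p * f p.2).
Proof.
move=> mf sf; have mi : measurable_fun setT (fun x : R => `|f x| / x).
  apply: measurable_funM; first exact: measurableT_comp.
  exact: measurable_inv.
apply: (@Rintegrable_le _ _ _ mu2 _ (fun p => tri p * (`|f p.2| / p.2))).
- by apply: measurable_funM; [exact: kb_mv kb|exact: measurable_comp_snd].
- move=> p; have /andP[v0 vt] := kb_v kb p.
  by rewrite normrM (ger0_norm v0) mulrA mulrAC ler_wpM2r.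
- apply: (Rintegrable2_tri mi).
  apply: (@Rintegrable_le _ _ _ mu _ (fun x => `|f x|)).
  + exact: measurable_funM.
  + move=> x; have [->|x0] := eqVneq x 0; first by rewrite mul0r normr0.
    by rewrite mulrCA mulfV// mulr1 normr_id.
  + exact: Rintegrable_norm.
Qed.

(** The bound [tri p / p.2] integrates to 1 over the fragments of a parent, so the perturbation of
    fragmentation costs no moment. *)
Lemma I2_v_le f : measurable_fun setT f -> Rintegrable mu f ->
  (forall x, 0 <= f x) -> (forall x, x <= 0 -> f x = 0) ->
  I2 (fun p => v p * f p.2) <= I1 f.
Proof.
move=> mf sf f0 fl0; have mi : measurable_fun setT (fun x : R => f x / x).
  by apply: measurable_funM => //; exact: measurable_inv.
(* At [x = 0] the quotient is 0 by convention, in agreement with [f 0 = 0]. *)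
have E x : x * (f x / x) = f x.
  have [->|x0] := eqVneq x 0; first by rewrite mul0r fl0.
  by rewrite mulrCA mulfV// mulr1.
have sxi : Rintegrable mu (fun x => x * (f x / x))
  by rewrite (_ : (fun _ => _) = f)//; exact/funext.
apply: (@le_trans _ _ (I2 (fun p => tri p * (f p.2 / p.2)))).
  apply: le_Int => [||p]; [exact: Rintegrable2_v|exact:
    (Rintegrable2_tri mi sxi)|].
  have /andP[v0 vt] := kb_v kb p.
  by rewrite [leRHS]mulrA mulrAC ler_wpM2r.
rewrite (I2_tri mi sxi); last by move=> x x0; rewrite fl0// mul0r.
by rewrite (@eq_Int _ _ _ mu _ f).
Qed.

Lemma Rintegrable2_frag f : measurable_fun setT f -> Rintegrable mu f ->
  Rintegrable mu (fun x => x * f x) ->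
  Rintegrable mu2 (fun p => (2 * tri p + eps * v p) * f p.2).
Proof.
move=> mf sf sxf.
rewrite (_ : (fun _ => _) = (fun p => 2 * (tri p * f p.2) + eps *
  (v p * f p.2))).
  apply: (RintegrableD (m := mu2)); apply: RintegrableZ; first exact:
    Rintegrable2_tri.
  exact: Rintegrable2_v.
by apply/funext => p; rewrite mulrDl !mulrA.
Qed.

Lemma measurable_frag : measurable_fun setT (fun p => 2 * tri p + eps * v p).
Proof.
by apply: measurable_funD; apply: measurable_funM => //;
  [exact: measurable_tri|exact: kb_mv kb].
Qed.

Lemma measurable_coag : measurable_fun setT (fun p => 1 + eps / 2 * w p).
Proof.
by apply: measurable_funD => //; apply: measurable_funM => //; exact: kb_mw kb.
Qed.

Lemma norm_coag p : `|1 + eps / 2 * w p| <= 1 + eps.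
Proof.
have /andP[w0 w1] := kb_w kb p.
have h0 : 0 <= eps * w p by rewrite mulr_ge0.
have h1 : eps * w p <= eps by rewrite ler_piMr.
by rewrite ger0_norm; lra.
Qed.

Lemma Rintegrable2_coag f g : Rintegrable mu f -> Rintegrable mu g ->
  Rintegrable mu2 (fun p => (1 + eps / 2 * w p) * (f p.1 * g p.2)).
Proof. by move=> sf sg; exact: (Rintegrable2_bprod measurable_coag norm_coag sf
  sg). Qed.

End kernel_integrable.

End weak_form.

(** * From the pointwise equation to the weak formulation *)

Section balance_algebra.
Variable R : realType.
Implicit Types a b c z r e : R.

Lemma coag_split a b c z r e : (a - b - c) * (1 + e / 2 * z) * r =
  2^-1 * (a * ((2 + e * z) * r) - b * ((2 + e * z) * r) - c * ((2 + e * z) *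
    r)).
Proof. by field. Qed.

Lemma frag_split a b c z :
  (a - b / 2) * c * z = a * (c * z) - 2^-1 * (b * (c * z)).
Proof. by field. Qed.

Lemma balance_split a b c z : 2^-1 * a - b - 2^-1 * c + z = 0 ->
  2^-1 * (a - b - b) + (z - 2^-1 * c) = 0.
Proof. by move=> h; lra. Qed.

Lemma balance_factor r a b c z :
  2^-1 * (r * a) - r * b - 2^-1 * (r * c) + r * z =
  r * (2^-1 * a - b - 2^-1 * c + z).
Proof. by field. Qed.

Lemma balance_pointwise a b c z : a - 2^-1 * b - 2^-1 * b + (- (2^-1 * c) + z) =
  a - b - 2^-1 * c + z.
Proof. by field. Qed.

End balance_algebra.

Section equilibrium_weak.
Variable R : realType.
Local Notation mu := (@lebesgue_measure R).
Local Notation mu2 := (mu \x mu)%E.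
Local Notation I1 := (Int mu).
Local Notation I2 := (Int mu2).
Local Notation D := (halfline R).

Definition extend_kernel (K : R -> R -> R) : R * R -> R :=
  (fun p => K p.1 p.2) \_ (D `*` D).

Lemma measurable_halfline : measurable D.
Proof.
rewrite (_ : D = `]0, +oo[%classic); first exact: measurable_itv.
by apply/seteqP; split => x /=; rewrite in_itv/= andbT.
Qed.

Lemma measurable_extend_kernel K : sym_kernel K ->
  measurable_fun setT (extend_kernel K).
Proof.
move=> [mK _ _].
have mDD : measurable (D `*` D) by apply: measurableX;
  exact: measurable_halfline.
exact: (iffLR (measurable_restrictT _ mDD) mK).
Qed.

Lemma extend_kernelE K x y :
  extend_kernel K (x, y) = if (0 < x) && (0 < y) then K x y else 0.
Proof.
rewrite /extend_kernel patchE; case: ifPn => [|].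
  by rewrite inE/= => -[/= x0 y0]; rewrite ifT//; apply/andP.
by rewrite notin_setE => h; case: ifPn => // /andP[x0 y0]; case: h; split.
Qed.

Variables W V : R -> R -> R.
Hypotheses (hW : sym_kernel W) (hV : sym_kernel V).
Hypothesis hW1 : forall x y, 0 < x -> 0 < y -> 0 <= W x y <= 1.
Hypothesis hV1 : forall x y, 0 < x -> 0 < y -> 0 <= V x y <= 1 / (x + y).

Definition coag_kernel := extend_kernel W.

Definition frag_kernel (p : R * R) := extend_kernel V (p.1, p.2 - p.1).

Lemma coag_kernelC x y : coag_kernel (x, y) = coag_kernel (y, x).
Proof.
rewrite /coag_kernel !extend_kernelE andbC; case: ifP => // /andP[y0 x0].
by have [_ + _] := hW; apply.
Qed.

Lemma kernel_bounds_extend : kernel_bounds coag_kernel frag_kernel.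
Proof.
split.
- exact: measurable_extend_kernel.
- have := measurable_comp_shear (-1) (measurable_extend_kernel hV).
  rewrite (_ : (fun _ => _) = frag_kernel)//; apply/funext => p.
  by rewrite /frag_kernel mulN1r.
- move=> [x y]; rewrite /coag_kernel extend_kernelE.
  by case: ifP => [/andP[x0 y0]|_]; [exact: hW1|rewrite lexx ler01].
- move=> [y v]; rewrite /frag_kernel/= extend_kernelE subr_gt0 /tri/=.
  case: ifP => [/andP[y0 yv]|]; last first.
    by case: (0 < y); case: (y < v) => //= _; rewrite ?(mul0r,mulr0) lexx.
  by rewrite y0 yv mulr1; have := hV1 y0 (_ : 0 < v - y);
    rewrite subr_gt0 subrKC; apply.
Qed.

Variable eps : R.
Hypothesis eps_ge0 : 0 <= eps.
Variable Q : R -> R.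
Let K x y := 2 + eps * W x y.
Let F x y := 2 + eps * V x y.
Let kb := kernel_bounds_extend.
(** The absolute value makes [q] nonnegative everywhere, as [profile] demands. [q0] keeps the values
    of [Q], for which the equation is given; the two agree almost everywhere. *)
Let q := (fun x => `|Q x|) \_ D.
Let q0 := Q \_ D.
Let w := coag_kernel.
Let v := frag_kernel.

Let q0_gt0 x : 0 < x -> q0 x = Q x.
Proof. by move=> x0; rewrite /q0 patchE ifT// inE. Qed.

Let q0_le0 x : x <= 0 -> q0 x = 0.
Proof.
by move=> x0; rewrite /q0 patchE ifF//; apply/negbTE; rewrite notin_setE/=
  leNgt in x0 *; apply/negP.
Qed.

Let qE x : q x = `|q0 x|.
Proof. by rewrite /q /q0 !patchE; case: ifP; rewrite ?normr0. Qed.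

Hypothesis L1Q : L1_weighted 1 Q.

Let mq0 : measurable_fun setT q0.
Proof. by case: L1Q => mQ _;
  exact: (iffLR (measurable_restrictT _ measurable_halfline) mQ). Qed.

Let s1q0 : Rintegrable mu (fun x : R => (1 + x) * q0 x).
Proof.
have [mQ iQ] := L1Q; apply/integrableP; split.
  by apply/measurable_EFinP; apply: measurable_funM => //;
    exact: measurable_funD.
rewrite integral_mkcond in iQ; apply: le_lt_trans iQ.
rewrite le_eqVlt; apply/orP; left; apply/eqP; apply: eq_integral => x _.
rewrite patchE; case: ifPn => [|/negP].
  rewrite inE/= => x0; rewrite q0_gt0// powRr1 ?addr_ge0// ?ltW//.
  by rewrite normrM (ger0_norm (_ : 0 <= 1 + x))// addr_ge0// ltW.
rewrite inE/= => /negP; rewrite -leNgt => x0.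
by rewrite q0_le0// mulr0 normr0.
Qed.

Let sq0 : Rintegrable mu q0.
Proof.
apply: (Rintegrable_le (m := mu) mq0 _ (Rintegrable_norm s1q0)) => x.
have [x0|x0] := leP x 0; first by rewrite q0_le0 ?mulr0.
by rewrite normrM ler_peMl// ger0_norm; lra.
Qed.

Let sxq0 : Rintegrable mu (fun x : R => x * q0 x).
Proof.
have mxq0 : measurable_fun setT (fun x : R => x * q0 x)
  by exact: measurable_funM.
apply: (Rintegrable_le (m := mu) mxq0 _ (Rintegrable_norm s1q0)) => x.
have [x0|x0] := leP x 0; first by rewrite q0_le0 ?mulr0.
by rewrite !normrM ler_wpM2r// !ger0_norm; lra.
Qed.

Hypothesis Qge0 : {ae lebesgue_measure, forall x : R, 0 < x -> 0 <= Q x}.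

Let q_ae : {ae mu, forall x, q0 x = q x}.
Proof.
apply: (ae_mono (m := mu) Qge0) => x Qx; rewrite qE.
have [x0|x0] := leP x 0; first by rewrite q0_le0// normr0.
by rewrite q0_gt0// ger0_norm// Qx.
Qed.

Let mq : measurable_fun setT q.
Proof. by rewrite (_ : q = (fun x => `|q0 x|));
  [exact: measurableT_comp|exact/funext]. Qed.

Lemma profile_equilibrium : profile (mass Q) q.
Proof.
split=> //.
- by move=> x; rewrite qE.
- by move=> x x0; rewrite qE q0_le0 ?normr0.
- by rewrite (_ : q = (fun x => `|q0 x|));
  [exact: Rintegrable_norm|exact/funext].
- rewrite (_ : (fun _ => _) = (fun x => `|x * q0 x|)); first exact:
  Rintegrable_norm.
  apply/funext => x; rewrite qE normrM.
  have [x0|x0] := leP x 0; first by rewrite q0_le0 ?normr0 ?mulr0.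
  by rewrite (gtr0_norm x0).
- rewrite /mass Rintegral_mkcond.
  apply: (ae_eq_Int (m := mu)).
  + exact: measurable_funM.
  + rewrite (_ : _ \_ _ = (fun x : R => x * q0 x)); first exact:
    measurable_funM.
    by apply/funext => x; rewrite /q0 !patchE; case: ifP; rewrite ?mulr0.
  + apply: (ae_mono (m := mu) q_ae) => x <-.
    by rewrite /q0 !patchE; case: ifP; rewrite ?mulr0.
Qed.


Let kq (p : R * R) := (2 + eps * w p) * (q0 p.1 * q0 p.2).
Let G (p : R * R) := (2 * tri p + eps * v p) * q0 p.2.

Let mkw : measurable_fun setT (fun p => 2 + eps * w p).
Proof. by apply: measurable_funD => //; apply: measurable_funM => //;
  exact: kb_mw kb. Qed.

Let nkw p : `|2 + eps * w p| <= 2 + eps.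
Proof.
have /andP[w0 w1] := kb_w kb p.
have h0 : 0 <= eps * w p by rewrite mulr_ge0.
have h1 : eps * w p <= eps by rewrite ler_piMr.
by rewrite ger0_norm; lra.
Qed.

Let skq : Rintegrable mu2 kq.
Proof. exact: (Rintegrable2_bprod mkw nkw sq0 sq0). Qed.

Let sG : Rintegrable mu2 G.
Proof. exact: (Rintegrable2_frag eps kb mq0 sq0 sxq0). Qed.

Let wE x y : 0 < x -> 0 < y -> w (x, y) = W x y.
Proof. by move=> x0 y0; rewrite /w /coag_kernel extend_kernelE x0 y0. Qed.

Let vE x y : 0 < x -> 0 < y -> v (x, x + y) = V x y.
Proof.
by move=> x0 y0; rewrite /v /frag_kernel extend_kernelE/=
  addrAC subrr add0r x0 y0.
Qed.

Let v_out x y : ~~ (0 < x < y) -> v (x, y) = 0.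
Proof. by move=> h; rewrite /v /frag_kernel extend_kernelE/=
  subr_gt0 (negbTE h). Qed.

Let coag_gainE x : 0 < x ->
  (\int[lebesgue_measure]_(y in `]0%R, x[) (K (x - y) y * Q (x - y) * Q y))%R =
  I1 (fun y => kq (x - y, y)).
Proof.
move=> x0; rewrite Rintegral_mkcond; apply: (eq_Int mu) => y.
rewrite patchE mem_setE in_itv/= /kq/=.
have [y0|y0] := leP y 0; first by rewrite (q0_le0 y0) !mulr0.
have [xy|xy] := leP x y.
  by rewrite (@q0_le0 (x - y)) ?subr_le0// mul0r mulr0.
by rewrite wE ?subr_gt0// !q0_gt0 ?subr_gt0// mulrA.
Qed.

Let coag_lossE x : 0 < x ->
  Q x * (\int[lebesgue_measure]_(y in D) (K x y * Q y))%R =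
    I1 (fun y => kq (x, y)).
Proof.
move=> x0; rewrite Rintegral_mkcond.
have -> : (fun y => K x y * Q y) \_ D = (fun y => (2 + eps * w (x, y)) * q0 y).
  apply/funext => y; rewrite /q0 !patchE; case: ifPn; last by rewrite mulr0.
  by rewrite inE => y0; rewrite wE.
have mwx : measurable_fun setT (fun y => 2 + eps * w (x, y)).
  exact: measurable_fun_pair2 mkw.
have swx := Rintegrable_bounded (m := mu) mwx (fun y => nkw (x, y)) sq0.
rewrite -[RHS]/(I1 _) -q0_gt0// -[LHS]/(q0 x * I1 _) -(IntZ _ swx).
by apply: (eq_Int mu) => y; rewrite /kq/= mulrCA.
Qed.

Let frag_lossE x : 0 < x ->
  Q x * (\int[lebesgue_measure]_(y in `]0%R, x[) F y (x - y))%R =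
    I1 (fun y => G (y, x)).
Proof.
move=> x0; rewrite Rintegral_mkcond.
have -> : (fun y => F y (x - y)) \_ `]0%R, x[ =
  (fun y => 2 * tri (y, x) + eps * v (y, x)).
  apply/funext => y; rewrite patchE mem_setE in_itv/= /tri/=.
  case: ifPn => [/andP[y0 yx]|h].
    by rewrite y0 yx /F -vE ?subr_gt0// subrKC !mulr1.
  by rewrite v_out// mulr0 addr0; case: (0 < y) h; case: (y < x) => //=;
    rewrite ?(mulr0,mul0r).
have mvx : measurable_fun setT (fun y => 2 * tri (y, x) + eps * v (y, x)).
  exact: measurable_fun_pair1 (measurable_frag eps kb).
have svx : Rintegrable mu (fun y => 2 * tri (y, x) + eps * v (y, x)).
  apply: (Rintegrable_le (m := mu) mvx _ (RintegrableZ (2 + eps / x)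
    (Rintegrable_tri1 x))) => y.
  have /andP[v0 vt] := kb_v kb (y, x).
  rewrite ger0_norm; last by rewrite addr_ge0 ?mulr_ge0// tri_ge0.
  by rewrite [leRHS]mulrDl lerD2l -mulrA ler_wpM2l// mulrC.
rewrite -q0_gt0// -[LHS]/(q0 x * I1 _) -(IntZ _ svx).
by apply: (eq_Int mu) => y; rewrite /G/= mulrC.
Qed.

Let frag_gainE x : 0 < x ->
  (\int[lebesgue_measure]_(y in D) (F x y * Q (x + y)))%R =
  I1 (fun y => G (x, y + 1 * x)).
Proof.
move=> x0; rewrite Rintegral_mkcond; apply: (eq_Int mu) => y.
rewrite patchE mul1r /G/= [y + x]addrC; case: ifPn => [|/negP].
  rewrite inE/= => y0; rewrite vE// q0_gt0 ?addr_gt0// /tri/= x0.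
  by rewrite ltrDl -[D y]/(is_true (0 < y)) in y0 *; rewrite y0 !mulr1.
rewrite inE/= => /negP y0; rewrite v_out; last by rewrite x0/= ltrDl.
by rewrite /tri/= ltrDl (negbTE y0) !mulr0 addr0 mul0r.
Qed.

Let kqz x y : x <= 0 \/ y <= 0 -> kq (x, y) = 0.
Proof. by rewrite /kq/= => -[] /q0_le0 ->; rewrite ?(mul0r,mulr0). Qed.

Let Gz x y : ~~ (0 < x < y) -> G (x, y) = 0.
Proof.
move=> h; rewrite /G/= v_out// /tri/= mulr0 addr0.
by case: (0 < x) h; case: (x < y) => //=; rewrite ?(mulr0,mul0r).
Qed.

Hypothesis eqQ : {ae lebesgue_measure, forall x : R, 0 < x ->
  coag K Q Q x + frag F Q x = 0}.

(** The equation in terms of the merging density [kq] and the fragment density [G], on the whole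
    line: for [x <= 0] every term vanishes, since sizes of positive clusters add up to a positive
    size. The two loss integrals of [coag] coincide on the diagonal and merge into one. *)
Let balance : {ae mu, forall x : R,
  2^-1 * I1 (fun y => kq (x - y, y)) - I1 (fun y => kq (x, y))
  - 2^-1 * I1 (fun y => G (y, x)) + I1 (fun y => G (x, y + 1 * x)) = 0}.
Proof.
apply: (ae_mono (m := mu) eqQ) => x eqx.
have [x0|x0] := leP x 0.
  have z h : (forall y, h y = 0) -> I1 h = 0.
    by move=> h0; rewrite (@eq_Int _ _ _ mu _ (fun=> 0))// Int0.
  rewrite !z ?(mulr0,subr0,addr0)// => y.
  - by rewrite Gz// negb_and -leNgt x0.
  - by rewrite Gz//; apply/negP => /andP[] /lt_trans/[apply]; rewrite ltNge x0.
  - by apply: kqz; left.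
  - have [y0|y0] := leP y 0; apply: kqz; [by right|left].
    by rewrite subr_le0 (le_trans x0)// ltW.
rewrite -(eqx x0) /coag /frag coag_gainE// frag_gainE//.
by rewrite -!mulrA coag_lossE// frag_lossE// balance_pointwise.
Qed.


Let kqC x y : kq (x, y) = kq (y, x).
Proof. by rewrite /kq/w/= coag_kernelC [q0 x * _]mulrC. Qed.

(** The balance is multiplied by [phi] and integrated; shears and swaps bring each of the four terms
    to the coordinates of the two merging clusters, or of fragment and parent. Boundedness of [phi]
    makes all four double integrals converge separately. *)
Lemma weak_solution_equilibrium : weak_solution w v eps q.
Proof.
move=> phi M mphi phiM.
have m1 := measurable_comp_fst mphi; have m2 := measurable_comp_snd mphi;
  have m12 := measurable_comp_add mphi.
pose K1 (p : R * R) := phi (p.1 + p.2) * kq p.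
have sK1 : Rintegrable mu2 K1
  by exact: (Rintegrable_bounded (m := mu2) m12 (fun=> phiM _) skq).
pose K2 (p : R * R) := phi p.1 * kq p.
have sK2 : Rintegrable mu2 K2
  by exact: (Rintegrable_bounded (m := mu2) m1 (fun=> phiM _) skq).
pose K2' (p : R * R) := phi p.2 * kq p.
have sK2' : Rintegrable mu2 K2'
  by exact: (Rintegrable_bounded (m := mu2) m2 (fun=> phiM _) skq).
pose K3 (p : R * R) := phi p.2 * G p.
have sK3 : Rintegrable mu2 K3
  by exact: (Rintegrable_bounded (m := mu2) m2 (fun=> phiM _) sG).
pose K4 (p : R * R) := phi p.1 * G p.
have sK4 : Rintegrable mu2 K4
  by exact: (Rintegrable_bounded (m := mu2) m1 (fun=> phiM _) sG).
(* The balance contains the coagulation loss once; by symmetry of [kq] it is half the sum of the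
   losses of the two partners, as in the weak formulation. *)
have K2'E : I2 K2' = I2 K2.
  rewrite -(I2_swap sK2); apply: (eq_Int mu2) => -[x y].
  by rewrite /K2 /K2'/= kqC.
(* This change of variables is the shear with [c = -1] conjugated by the swap. *)
have shearN k : Rintegrable mu2 k ->
    Rintegrable mu2 (fun p : R * R => k (p.1 - p.2, p.2)) /\
    I2 (fun p : R * R => k (p.1 - p.2, p.2)) = I2 k.
  move=> sk; have s1 := Rintegrable2_swap sk; have s2 :=
    Rintegrable2_shear (-1) s1.
  have E : (fun p : R * R => k (p.1 - p.2, p.2)) =
      (fun p : R * R => k (p.1 + -1 * p.2, p.2)).
    by apply/funext => p; rewrite mulN1r.
  rewrite E; split; first exact: (Rintegrable2_swap s2).
  by rewrite (I2_swap s2) (I2_shear (-1) s1) (I2_swap sk).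
have [sk1 _] := shearN _ skq; have [_ T1] := shearN _ sK1.
have sk3 := Rintegrable2_swap sG; have T3 := I2_swap sK3.
have sk4 := Rintegrable2_shear 1 sG; have T4 := I2_shear 1 sK4.
have E1 := I2_mul_fst mphi phiM sk1.
have E2 := I2_mul_fst mphi phiM skq.
have E3 := I2_mul_fst mphi phiM sk3.
have E4 := I2_mul_fst mphi phiM sk4.
have S (k : R * R -> R) (sk : Rintegrable mu2 k) :
    Rintegrable mu (fun x => phi x * I1 (fun y => k (x, y))).
  exact: (Rintegrable_bounded (m := mu) mphi phiM (Rintegrable_iter1 sk)).
have S1 := S _ sk1; have S2 := S _ skq; have S3 := S _ sk3; have S4 := S _ sk4.
have T1' : I2 (fun p : R * R => phi p.1 * kq (p.1 - p.2, p.2)) = I2 K1.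
  by rewrite -T1; apply: (eq_Int mu2) => p; rewrite /K1/= subrK.
rewrite T1' in E1; rewrite T3 in E3; rewrite T4 in E4.
have eq0 : 2^-1 * I2 K1 - I2 K2 - 2^-1 * I2 K3 + I2 K4 = 0.
  rewrite -E1 -[I2 K2]E2 -E3 -E4 /=.
  rewrite -(IntZ _ S1) -(IntZ _ S3).
  rewrite -(IntB (RintegrableZ _ S1) S2) -(IntB (RintegrableB (RintegrableZ _
    S1) S2) (RintegrableZ _ S3)).
  rewrite -(IntD (RintegrableB (RintegrableB (RintegrableZ _ S1) S2)
    (RintegrableZ _ S3)) S4).
  rewrite -[RHS](Int0 mu); apply: (ae_eq_Int (m := mu)) => //.
    exact: (Rintegrable_measurable (RintegrableD (RintegrableB (RintegrableB
      (RintegrableZ _ S1) S2) (RintegrableZ _ S3)) S4)).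
  apply: (ae_mono (m := mu) balance) => x bx.
  by rewrite -[RHS](mulr0 (phi x)) -bx; exact: balance_factor.
have mk : measurable_fun setT (fun p : R * R =>
    (phi (p.1 + p.2) - phi p.1 - phi p.2) * (1 + eps / 2 * w p)).
  exact: (measurable_funM (measurable_coag_test mphi) (measurable_coag eps kb)).
have nk p : `|(phi (p.1 + p.2) - phi p.1 - phi p.2) * (1 + eps / 2 * w p)| <=
    (M + M + M) * (1 + eps).
  by rewrite normrM ler_pM//; [exact: coag_bounded|exact: norm_coag kb eps_ge0
    p].
have sq : Rintegrable mu q by exact: pf_summ profile_equilibrium.
have sxq : Rintegrable mu (fun x : R => x * q x)
  by exact: pf_summx profile_equilibrium.
have mb := measurable_frag_test mphi.
have mk' : measurable_fun setT (fun p : R * R =>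
    (phi p.1 - phi p.2 / 2) * (2 * tri p + eps * v p)).
  exact: (measurable_funM mb (measurable_frag eps kb)).
have sG' f : measurable_fun setT f -> Rintegrable mu f ->
  Rintegrable mu (fun x : R => x * f x) ->
    Rintegrable mu2 (fun p : R * R =>
      (phi p.1 - phi p.2 / 2) * (2 * tri p + eps * v p) * f p.2).
  move=> mf sf sxf.
  rewrite (_ : (fun _ => _) = (fun p : R * R =>
     (phi p.1 - phi p.2 / 2) * ((2 * tri p + eps * v p) * f p.2))).
    exact: (Rintegrable_bounded (m := mu2) mb (fun p => frag_bounded p phiM)
      (Rintegrable2_frag eps kb mf sf sxf)).
  by apply/funext => p; rewrite mulrA.
have C1 : I2 (fun p : R * R => (phi (p.1 + p.2) - phi p.1 - phi p.2) *
      ((1 + eps / 2 * w p) * (q p.1 * q p.2))) =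
    2^-1 * (I2 K1 - I2 K2 - I2 K2').
  rewrite -(IntB sK1 sK2) -(IntB (RintegrableB sK1 sK2) sK2')
    -(IntZ _ (RintegrableB (RintegrableB sK1 sK2) sK2')).
  have := ae_eq_I2_prod mq0 mq q_ae (Rintegrable2_bprod mk nk sq0 sq0)
    (Rintegrable2_bprod mk nk sq sq) mk.
  move=> E; transitivity (I2 (fun p : R * R => (phi (p.1 + p.2) - phi p.1 - phi
    p.2) *
     (1 + eps / 2 * w p) * (q p.1 * q p.2))).
    by apply: (eq_Int mu2) => p; rewrite mulrA.
  rewrite -E; apply: (eq_Int mu2) => p; rewrite /K1 /K2 /K2' /kq.
  exact: coag_split.
have C2 : I2 (fun p : R * R => (phi p.1 - phi p.2 / 2) *
  ((2 * tri p + eps * v p) * q p.2)) =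
    I2 K4 - 2^-1 * I2 K3.
  rewrite -(IntZ _ sK3) -(IntB sK4 (RintegrableZ _ sK3)).
  have := ae_eq_I2_snd mq0 mq q_ae (sG' _ mq0 sq0 sxq0) (sG' _ mq sq sxq) mk'.
  move=> E; transitivity (I2 (fun p : R * R => (phi p.1 - phi p.2 / 2) *
     (2 * tri p + eps * v p) * q p.2)).
    by apply: (eq_Int mu2) => p; rewrite mulrA.
  rewrite -E; apply: (eq_Int mu2) => p; rewrite /K3 /K4 /G.
  exact: frag_split.
rewrite C1 C2 K2'E; exact: balance_split.
Qed.

End equilibrium_weak.

(** * Test functions *)

Section truncations.
Variable R : realType.
Local Notation mu := (@lebesgue_measure R).
Local Notation mu2 := (mu \x mu)%E.
Local Notation I1 := (Int mu).
Local Notation I2 := (Int mu2).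
Implicit Types (a b x y t : R) (f g phi : R -> R).

(** The positive parts in [trunc] and [weight] keep these functions bounded on the whole line; the
    densities they are tested against vanish on the negative axis. *)
Definition trunc a x : R := Num.min a (Num.max x 0).
Definition step a x : R := (a < x)%R%:R.
Definition weight x : R := (1 + Num.max x 0)^-1.

Lemma measurable_trunc a : measurable_fun setT (trunc a).
Proof. by apply: measurable_minr => //; exact: measurable_maxr. Qed.

Lemma measurable_step a : measurable_fun setT (step a).
Proof. exact: measurable_ltr_nat. Qed.

Lemma measurable_weight : measurable_fun setT weight.
Proof.
apply: (measurableT_comp (@measurable_inv R)); apply: measurable_funD => //.
exact: measurable_maxr.
Qed.

Lemma weight_den_gt0 x : 0 < 1 + Num.max x 0.
Proof. by rewrite ltr_pwDl// le_max lexx orbT. Qed.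

Lemma weight_gt0 x : 0 < weight x.
Proof. by rewrite invr_gt0 weight_den_gt0. Qed.

Lemma weight_le1 x : weight x <= 1.
Proof. by rewrite invf_le1 ?weight_den_gt0// lerDl le_max lexx orbT. Qed.

Lemma norm_weight x : `|weight x| <= 1.
Proof. by rewrite gtr0_norm ?weight_gt0// weight_le1. Qed.

Lemma Rintegrable_weight_moment f : Rintegrable mu (fun x => x * f x) ->
  Rintegrable mu (fun x => x * weight x * f x).
Proof.
move=> sxf; rewrite (_ : (fun _ => _) = (fun x => weight x * (x * f x))).
  exact: (Rintegrable_bounded (m := mu) measurable_weight norm_weight sxf).
by apply/funext => x; rewrite mulrCA mulrA.
Qed.

Lemma weightE x : 0 <= x -> weight x = (1 + x)^-1.
Proof. by move=> x0; rewrite /weight max_l. Qed.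

Lemma trunc_ge0 a x : 0 <= a -> 0 <= trunc a x.
Proof. by move=> a0; rewrite le_min a0 le_max lexx orbT. Qed.

Lemma norm_trunc_le a x : 0 <= a -> `|trunc a x| <= a.
Proof. by move=> a0; rewrite ger0_norm ?trunc_ge0// ge_min lexx. Qed.

Lemma norm_trunc_le_id a x : 0 <= a -> 0 <= x -> `|trunc a x| <= x.
Proof. by move=> a0 x0; rewrite ger0_norm ?trunc_ge0// ge_min max_l// lexx
  orbT. Qed.

(** The increment of a truncation is again a truncation, at the remaining height. This, like
    [step_shift] for indicators, turns coagulation gain minus one loss into a convolution with
    [S]. *)
Lemma trunc_shift a x y : 0 <= a -> 0 <= x -> 0 <= y ->
  trunc a (x + y) - trunc a x = trunc (Num.max (a - x) 0) y.
Proof.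
move=> a0 x0 y0; rewrite /trunc [Num.max (x + y) 0]max_l ?addr_ge0//
  [Num.max x 0]max_l//.
rewrite [Num.max y 0]max_l//.
have [xa|ax] := leP x a.
  rewrite [Num.max _ _]max_l ?subr_ge0//.
  by rewrite addrC addr_minr addKr [- x + a]addrC.
rewrite [Num.max _ _]max_r; last by rewrite subr_le0 ltW.
by rewrite !min_l ?subrr// (le_trans (ltW ax))// lerDl.
Qed.

Lemma norm_step_le1 a x : `|step a x| <= 1.
Proof. by rewrite /step; case: (a < x); rewrite ?normr1 ?normr0. Qed.

Lemma step_ge0 a x : 0 <= step a x.
Proof. by []. Qed.

(** The factor [(1 + a)^-1] is the origin of the decay in [a] of the error in the equation for
    [H]. *)
Lemma norm_step_le a x : 0 <= a -> 0 <= x -> `|step a x| <=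
  (1 + a)^-1 * (1 + x).
Proof.
move=> a0 x0; rewrite ger0_norm ?step_ge0// /step; have [ax|_] := ltP a x.
  by rewrite mulrC ler_pdivlMr ?mul1r ?lerD2l ?ltW//; lra.
by rewrite mulr_ge0 ?invr_ge0//; lra.
Qed.

Lemma step_shift a x y : 0 < y ->
  step a (x + y) - step a x = (x <= a)%R%:R * step (a - x) y.
Proof.
move=> y0; rewrite /step ltrBlDl; have [xa|ax] := leP x a.
  by rewrite subr0 mul1r.
by rewrite (lt_trans ax) ?ltrDl// subrr mul0r.
Qed.

Lemma I1_indic_itv a b :
  I1 (fun y => (a < y)%R%:R * (y < b)%R%:R) = Num.max (b - a) 0.
Proof.
rewrite (_ : (fun _ => _) = \1_(`]a, b[%classic : set R)).
  rewrite /Int /Rintegral (integral_indic mu measurableT)//= setIT.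
  rewrite lebesgue_measure_itv/= lte_fin; case: ltP => ab.
    by rewrite /= max_l// subr_ge0 ltW.
  by rewrite /= max_r// subr_le0.
apply/funext => y; rewrite indicE mem_setE in_itv/=.
by case: (a < y); case: (y < b); rewrite ?(mulr0,mul0r,mulr1).
Qed.

Lemma I1_tri_step a b : 0 <= a ->
  I1 (fun y => step a y * tri (y, b)) = Num.max (b - a) 0.
Proof.
move=> a0; rewrite -I1_indic_itv; apply: (eq_Int mu) => y; rewrite /step /tri/=.
have [ay|] := ltP a y; last by rewrite !mul0r.
by rewrite (le_lt_trans a0 ay) mul1r.
Qed.

Lemma Rintegrable_tri_mul phi (M : R) b : measurable_fun setT phi ->
  (forall x, `|phi x| <= M) -> Rintegrable mu (fun y => phi y * tri (y, b)).
Proof. by move=> mphi phiM; exact: (Rintegrable_bounded (m := mu) mphi phiM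
  (Rintegrable_tri1 b)). Qed.

Lemma Rintegrable_tri_id b : 0 <= b -> Rintegrable mu (fun y => y * tri (y, b)).
Proof.
move=> b0; rewrite (_ : (fun _ => _) = (fun y => trunc b y * tri (y, b))).
  by apply: (Rintegrable_tri_mul _ (measurable_trunc b)) => x;
    exact: norm_trunc_le.
apply/funext => y; rewrite /tri/=.
have [y0|] := ltP 0 y; last by rewrite !(mul0r, mulr0).
have [yb|] := ltP y b; last by rewrite !mulr0.
by rewrite /trunc max_l ?min_r// ltW.
Qed.

(** Fubini on the triangle [0 < y < v < b]: if [X] is the integral, one order of integration gives
    [b ^+ 2 - X] and the other gives [X]. *)
Lemma I1_tri_id b : 0 <= b -> I1 (fun y => y * tri (y, b)) = b ^+ 2 / 2.
Proof.
move=> b0; pose f y := tri (y, b).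
have mf : measurable_fun setT f
  by exact: Rintegrable_measurable (Rintegrable_tri1 b).
have sxf : Rintegrable mu (fun y => y * f y) by exact: Rintegrable_tri_id.
have sf2 := Rintegrable2_tri mf sxf.
have f0 v : v <= 0 -> f v = 0 by move=> v0; rewrite /f /tri/= ltNge v0 mul0r.
have := I2_tri mf sxf f0.
rewrite I2_iter1//= (@eq_Int _ _ _ mu _ (fun t => b * tri (t, b) - t * tri
  (t, b))).
  rewrite (IntB (RintegrableZ _ (Rintegrable_tri1 b)) sxf)
    (IntZ _ (Rintegrable_tri1 b)) I1_tri//.
  by rewrite /f expr2; lra.
move=> t; rewrite -mulrBl /tri/=; have [t0|t0] := ltP 0 t; last first.
    by rewrite mul0r mulr0; rewrite (@eq_Int _ _ _ mu _ (fun=> 0)) ?Int0// =>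
      y; rewrite !mul0r.
  rewrite (@eq_Int _ _ _ mu _ (fun y => (t < y)%R%:R * (y < b)%R%:R)).
    rewrite I1_indic_itv; have [tb|bt] := ltP t b; last
      by rewrite max_r ?mulr0// subr_le0.
    by rewrite max_l ?mulr1// subr_ge0 ltW.
move=> y; rewrite /f /tri/= mul1r; have [ty|] := ltP t y; last
  by rewrite !mul0r.
  by rewrite (lt_trans t0 ty) mul1r.
Qed.

End truncations.

(** * Fragmentation tested against truncations and indicators *)

Section fragmentation.
Variable R : realType.
Local Notation mu := (@lebesgue_measure R).
Local Notation mu2 := (mu \x mu)%E.
Local Notation I1 := (Int mu).
Local Notation I2 := (Int mu2).
Implicit Types (a b x y t : R) (f g phi : R -> R).

(** Both regimes of [trunc a b] are covered by one formula, affine in [trunc a b] for fixed [a] and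
    [b]. In [I2_frag] the products [b * trunc a b] then cancel and only [a * (b - trunc a b)]
    survives, which against zero mass is pure damping. *)
Lemma I1_tri_trunc a b : 0 <= a -> 0 <= b ->
  I1 (fun y => trunc a y * tri (y, b)) = (b * trunc a b + a * (b - trunc a b))
    / 2.
Proof.
move=> a0 b0; rewrite {2 3}/trunc (max_l b0).
have [ba|ab] := leP b a.
  rewrite (@eq_Int _ _ _ mu _ (fun y => y * tri (y, b))).
    by rewrite I1_tri_id// subrr mulr0 addr0 expr2.
  move=> y; rewrite /tri/=; have [y0|] := ltP 0 y; last
    by rewrite !(mul0r, mulr0).
  have [yb|] := ltP y b; last by rewrite !mulr0.
  by rewrite /trunc max_l ?min_r// ltW// (lt_le_trans yb).
rewrite (@eq_Int _ _ _ mu _ (fun y => y * tri (y, a) + a * (tri (y, b) - tri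
  (y, a)))).
  rewrite (IntD (Rintegrable_tri_id a0) (RintegrableZ _ (RintegrableB
    (Rintegrable_tri1 b) (Rintegrable_tri1 a)))).
  rewrite (IntZ _ (RintegrableB (Rintegrable_tri1 b) (Rintegrable_tri1 a)))
    (IntB (Rintegrable_tri1 b) (Rintegrable_tri1 a)).
  by rewrite I1_tri_id// !I1_tri//; field.
move=> y; rewrite /tri/=; have [y0|] := ltP 0 y; last
  by rewrite !(mul0r, mulr0, subr0, addr0).
have [ya|ay] := ltP y a.
  by rewrite (lt_trans ya ab) !mulr1 subrr mulr0 addr0 /trunc max_l ?min_r//
    ltW.
rewrite !mulr0 add0r subr0 /trunc max_l ?min_l//; exact: ltW.
Qed.

Lemma I2_frag phi (M : R) (Psi f : R -> R) : measurable_fun setT phi ->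
  (forall x, `|phi x| <= M) -> measurable_fun setT f ->
  Rintegrable mu (fun x => x * f x) -> (forall x, x <= 0 -> f x = 0) ->
  (forall v, 0 < v -> I1 (fun y => phi y * tri (y, v)) = Psi v) ->
  I2 (fun p => (phi p.1 - phi p.2 / 2) * (2 * (tri p * f p.2))) =
  I1 (fun v => (2 * Psi v - v * phi v) * f v).
Proof.
move=> mphi phiM mf sxf f0 PsiE.
have sk : Rintegrable mu2 (fun p => (phi p.1 - phi p.2 / 2) *
  (2 * (tri p * f p.2))).
  exact: (Rintegrable_bounded (m := mu2) (measurable_frag_test mphi)
    (fun p => frag_bounded p phiM) (RintegrableZ 2 (Rintegrable2_tri mf sxf))).
rewrite I2_iter2//; apply: (eq_Int mu) => v /=.
have [v0|v0] := leP v 0.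
  rewrite f0// mulr0 (@eq_Int _ _ _ mu _ (fun=> 0)) ?Int0// => y.
  by rewrite !mulr0.
rewrite (@eq_Int _ _ _ mu _ (fun y => (2 * f v) * (phi y * tri (y, v)) -
   (phi v * f v) * tri (y, v))); last by move=> y; field.
have s1 := Rintegrable_tri_mul v mphi phiM.
rewrite (IntB (RintegrableZ _ s1) (RintegrableZ _ (Rintegrable_tri1 v)))
  (IntZ _ s1) (IntZ _ (Rintegrable_tri1 v)).
by rewrite I1_tri ?ltW// PsiE//; ring.
Qed.

End fragmentation.

(** * Scalar inequalities behind the moment bounds *)

Lemma number_sqr_le (R : realType) (a b : R) : 0 < b -> a ^+ 2 <=
  b + a / 2 -> a <= b + 1 .
Proof.
move=> b0 h; rewrite leNgt; apply/negP => ab.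
have : (b + 1) * a <= a ^+ 2 by rewrite expr2 ler_wpM2r; lra.
have : b * 1 <= b * a by rewrite ler_wpM2l; lra.
lra.
Qed.

Section moment_algebra.
Variable R : realType.
Implicit Types m c x r a b k e w s t q u v : R.

Lemma number_balance m c x r : m * m <= c -> x <= m ->
  - c + (1 - 1 / 2) * (2 * r + x) = 0 -> m ^+ 2 <= r + m / 2.
Proof. by move=> *; rewrite expr2; lra. Qed.

(** An increasing test function gains at [x + y] at least what it loses at [x], so only the loss at
    [y] is charged, with a rate [1 + e / 2 * w] at most [3 / 2]. *)
Lemma coag_tail a b c e w q u : 0 <= b -> 0 <= c -> 0 <= q -> 0 <= u ->
  0 <= e * w -> e * w <= 1 -> u = 0 \/ b <= a ->
  - (3 / 2 * (q * (c * u))) <= (a - b - c) * ((1 + e / 2 * w) * (q * u)).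
Proof.
move=> b0 c0 q0 u0 ew0 ew1 [->|ba]; first by rewrite !mulr0 oppr0.
have h1 : 0 <= q * u by rewrite mulr_ge0.
have -> : (a - b - c) * ((1 + e / 2 * w) * (q * u)) =
  (a - b) * ((1 + e * w / 2) * (q * u)) - c * ((1 + e * w / 2) * (q * u))
    by ring.
have h2 : 0 <= (a - b) * ((1 + e * w / 2) * (q * u)).
  by rewrite mulr_ge0 ?subr_ge0// mulr_ge0//; lra.
have h3 : c * ((1 + e * w / 2) * (q * u)) <= c * (3 / 2 * (q * u)).
  by rewrite ler_wpM2l// ler_wpM2r//; lra.
have -> : q * (c * u) = c * (q * u) by ring.
lra.
Qed.

(** The gain caused by the perturbation is nonnegative and dropped; its loss is kept with [e]
    replaced by 1. *)
Lemma frag_tail a b t e v q : 0 <= a -> 0 <= b -> 0 <= v -> 0 <= q ->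
  0 <= e -> e <= 1 ->
  (a - b / 2) * (2 * (t * q)) - 1 / 2 * (v * (b * q)) <=
  (a - b / 2) * ((2 * t + e * v) * q).
Proof.
move=> a0 b0 v0 q0 e0 e1.
have vq : 0 <= v * q by rewrite mulr_ge0.
have h1 : 0 <= a * (e * (v * q)) by rewrite mulr_ge0// mulr_ge0.
have h2 : e * (b * (v * q)) <= b * (v * q) by rewrite ler_piMl// mulr_ge0.
have -> : (a - b / 2) * ((2 * t + e * v) * q) =
  (a - b / 2) * (2 * (t * q)) + a * (e * (v * q)) - e * (b * (v * q)) / 2
    by field.
have -> : v * (b * q) = b * (v * q) by ring.
lra.
Qed.

Lemma tail_balance a b m t x : a + b = 0 -> - (3 / 2 * (m * t)) <= a ->
  x - 2 * t - 1 / 2 * t <= b -> x <= (3 / 2 * m + 5 / 2) * t.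
Proof. by move=> *; lra. Qed.

Lemma step_weight_le x q : 0 < x -> 0 <= q ->
  step 1 x * q + (x * q - x * (step 1 x * q)) <= 2 * (x * weight x * q).
Proof.
move=> x0 q0; have w0 := weight_gt0 x.
have wx : weight x * (1 + x) = 1 by rewrite weightE ?ltW// mulVf// gt_eqF//;
  lra.
suff h : step 1 x + x * (1 - step 1 x) <= 2 * (x * weight x).
  have := ler_wpM2r q0 h; lra.
by rewrite /step; have [x1|x1] := ltP 1 x; rewrite ?mulr1n ?mulr0n /=; nra.
Qed.

Lemma sigma_balance x m t r s : x <= (3 / 2 * m + 5 / 2) * t -> m <= r + 1 ->
  t + (r - x) <= 2 * s -> t <= 2 * s -> 0 <= t -> 0 <= m -> 0 < r ->
  r <= (3 * r + 8) * s.
Proof.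
move=> h1 h2 h3 h4 t0 m0 r0.
have h5 : (3 / 2 * m + 3 / 2) * t <= (3 / 2 * m + 3 / 2) * (2 * s).
  by rewrite ler_wpM2l//; lra.
have h6 : (3 * m + 5) * s <= (3 * r + 8) * s by rewrite ler_wpM2r//; lra.
lra.
Qed.

End moment_algebra.

(** * Moment bounds *)

Section moments.
Variable R : realType.
Local Notation mu := (@lebesgue_measure R).
Local Notation mu2 := (mu \x mu)%E.
Local Notation I1 := (Int mu).
Local Notation I2 := (Int mu2).

Variables (w v : R * R -> R) (eps rho : R) (q : R -> R).
Hypotheses (kb : kernel_bounds w v) (eps0 : 0 <= eps) (eps1 : eps <= 1).
Hypotheses (rho0 : 0 < rho) (pq : profile rho q) (wq : weak_solution w v eps q).

Let sq := pf_summ pq.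
Let sxq := pf_summx pq.
Let mq := pf_meas pq.
Let q_ge0 := pf_ge0 pq.
Let q_le0 := pf_le0 pq.


Let sC := Rintegrable2_coag kb eps0 sq sq.
Let sV := Rintegrable2_v kb mq sq.
Let sT := Rintegrable2_tri mq sxq.
Let sF := Rintegrable2_frag eps kb mq sq sxq.

Let q2_ge0 p : 0 <= q p.1 * q p.2.
Proof. by rewrite mulr_ge0. Qed.

(** With test function 1, merging removes at least [(I1 q) ^+ 2] clusters, while fragmentation
    creates at most [rho + I1 q / 2], the second part coming from the perturbation. The quadratic
    loss wins. *)
Lemma number_le : I1 q <= rho + 1.
Proof.
apply: number_sqr_le => //; have q0 : 0 <= I1 q by exact: Int_ge0.
have n1 (x : R) : `|1 : R| <= 1 by rewrite normr1.
have := wq (phi := fun=> 1) (measurable_cst _) n1.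
rewrite (@eq_Int _ _ _ mu2 _ (fun p => - ((1 + eps / 2 * w p) *
  (q p.1 * q p.2)))); last first.
  by move=> p; rewrite subrr sub0r mulN1r.
rewrite (@eq_Int _ _ _ mu2 (fun p => (1 - 1 / 2) * _)
  (fun p => (1 - 1 / 2) * ((2 * tri p + eps * v p) * q p.2)))//.
rewrite (IntN sC) (IntZ _ sF).
have -> : I2 (fun p => (2 * tri p + eps * v p) * q p.2) =
    2 * rho + eps * I2 (fun p => v p * q p.2).
  rewrite -(pf_mass pq) -(I2_tri mq sxq q_le0) -(IntZ _ sT) -(IntZ _ sV).
  rewrite -(IntD (RintegrableZ _ sT) (RintegrableZ _ sV)).
  by apply: (eq_Int mu2) => p; rewrite mulrDl !mulrA.
have lo : I1 q * I1 q <= I2 (fun p => (1 + eps / 2 * w p) * (q p.1 * q p.2)).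
  rewrite -(I2_prod sq sq); apply: (le_Int (Rintegrable2_prod sq sq) sC) => p.
  rewrite ler_peMl// lerDl mulr_ge0//; last by case/andP: (kb_w kb p).
  by rewrite divr_ge0.
have hi := I2_v_le kb mq sq q_ge0 q_le0.
have v_ge0 : 0 <= I2 (fun p => v p * q p.2).
  by apply: Int_ge0 => p; rewrite mulr_ge0//; case/andP: (kb_v kb p).
have hi2 : eps * I2 (fun p => v p * q p.2) <= I1 q.
  by rewrite (le_trans _ hi)// ler_piMl.
exact: number_balance lo hi2.
Qed.

Let mphi := measurable_step (1 : R).
Let phiM := norm_step_le1 (1 : R).
Let f x := step 1 x * q x.

Let mf : measurable_fun setT f.
Proof. exact: measurable_funM. Qed.

Let sf : Rintegrable mu f.
Proof. exact: (Rintegrable_bounded (m := mu) mphi phiM sq). Qed.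

Let sxf : Rintegrable mu (fun x => x * f x).
Proof.
rewrite (_ : (fun _ => _) = (fun x => step 1 x * (x * q x))).
  exact: (Rintegrable_bounded (m := mu) mphi phiM sxq).
by apply/funext => x; rewrite mulrCA.
Qed.

Let f_ge0 x : 0 <= f x.
Proof. by rewrite mulr_ge0. Qed.

Let f_le0 x : x <= 0 -> f x = 0.
Proof. by move=> x0; rewrite /f q_le0// mulr0. Qed.

(* Tested against 1_(x > 1), the fragmentation gain prevents the mass from
   escaping to infinity. *)
Lemma tail_le : I1 (fun x => x * f x) <= (3 / 2 * I1 q + 5 / 2) * I1 f.
Proof.
have := wq mphi phiM.
set A := I2 _; set B := I2 _ => AB.
have s1 : Rintegrable mu2 (fun p => q p.1 * f p.2) by exact: Rintegrable2_prod.
have A_ge : - (3 / 2 * (I1 q * I1 f)) <= A.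
  rewrite -(I2_prod sq sf) -(IntZ _ s1) -(IntN (RintegrableZ _ s1)).
  apply: (le_Int (RintegrableN (RintegrableZ _ s1))).
    exact: (Rintegrable_bounded (m := mu2) (measurable_coag_test mphi)
      (fun p => coag_bounded p phiM) sC).
  move=> p; have /andP[w0 w1] := kb_w kb p.
  apply: coag_tail => //; try exact: step_ge0.
  - by rewrite mulr_ge0.
  - by rewrite (le_trans _ eps1)// ler_piMr.
  - have [p0|p0] := leP p.2 0; first by left; apply: q_le0.
    by right; rewrite /step ler_nat; case: ltP => // h;
      rewrite (lt_trans h)// ltrDl.
have sB0 : Rintegrable mu2 (fun p => (step 1 p.1 - step 1 p.2 / 2) *
  (2 * (tri p * q p.2))).
  exact: (Rintegrable_bounded (m := mu2) (measurable_frag_test mphi)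
    (fun p => frag_bounded p phiM) (RintegrableZ 2 sT)).
have sv1 := Rintegrable2_v kb mf sf.
have B_ge : I1 (fun v => (2 * Num.max (v - 1) 0 - v * step 1 v) * q v) - 1 / 2
  * I1 f <= B.
  rewrite -(I2_frag mphi phiM mq sxq q_le0); last first.
    by move=> y y0; rewrite I1_tri_step.
  have vf := I2_v_le kb mf sf f_ge0 f_le0.
  apply: (@le_trans _ _ (I2 (fun p => (step 1 p.1 - step 1 p.2 / 2) *
    (2 * (tri p * q p.2)))
     - 1 / 2 * I2 (fun p => v p * f p.2))).
    by rewrite lerD2l lerN2 ler_wpM2l.
  rewrite -(IntZ _ sv1) -(IntB sB0 (RintegrableZ _ sv1)).
  apply: (le_Int (RintegrableB sB0 (RintegrableZ _ sv1))).
    exact: (Rintegrable_bounded (m := mu2) (measurable_frag_test mphi)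
      (fun p => frag_bounded p phiM) sF).
  move=> p; have /andP[v0 _] := kb_v kb p.
  by apply: frag_tail => //; exact: step_ge0.
have E : I1 (fun v => (2 * Num.max (v - 1) 0 - v * step 1 v) * q v) =
    I1 (fun x => x * f x) - 2 * I1 f.
  rewrite -(IntZ _ sf) -(IntB sxf (RintegrableZ _ sf)); apply: (eq_Int mu) => x.
  rewrite /f /step; have [x1|x1] := ltP 1 x.
    by rewrite max_l ?subr_ge0 ?ltW//= mulr1n; ring.
  by rewrite max_r ?subr_le0//= mulr0n; ring.
rewrite E in B_ge; exact: tail_balance AB A_ge B_ge.
Qed.

(** The mass is split at size 1. Below 1, [x <= 2 * (x * weight x)]; above 1, [tail_le] bounds the
    mass by the number of clusters, and [1 <= 2 * (x * weight x)]. Adding up gives the factor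
    [3 * I1 q + 5], and [number_le] makes it [3 * rho + 8]. *)
Lemma sigma_ge : rho <= (3 * rho + 8) * I1 (fun x => x * weight x * q x).
Proof.
set sigma := I1 _.
have ssig := Rintegrable_weight_moment sxq.
have f_le : I1 f + (rho - I1 (fun x => x * f x)) <= 2 * sigma.
  rewrite -(pf_mass pq) -(IntB sxq sxf) -(IntD sf (RintegrableB sxq sxf))
    -(IntZ _ ssig).
  apply: (le_Int (RintegrableD sf (RintegrableB sxq sxf)) (RintegrableZ _
    ssig)) => x.
  have [x0|x0] := leP x 0; first by rewrite f_le0 ?q_le0// !(mulr0,subr0,addr0).
  exact: step_weight_le.
have T_le : I1 f <= 2 * sigma.
  rewrite (le_trans _ f_le)// lerDl subr_ge0 -(pf_mass pq).
  apply: (le_Int sxf sxq) => x.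
  have [x0|x0] := leP x 0; first by rewrite f_le0 ?q_le0.
  by rewrite ler_wpM2l ?(ltW x0)// ler_piMl// /step; case: (1 < x).
have fx_le : rho - I1 (fun x => x * f x) <= 2 * sigma - I1 f by rewrite lerBrDl.
have f0 : 0 <= I1 f by exact: Int_ge0.
have q0 : 0 <= I1 q by exact: Int_ge0.
exact: sigma_balance tail_le number_le f_le T_le f0 q0 rho0.
Qed.

End moments.

(** * Pointwise bounds for the difference of two solutions *)

Section difference_algebra.
Variable R : realType.
Implicit Types a b c d e k m n s t u v w x y z : R.

Lemma coag_bilinear t e w a b c d :
  t * ((1 + e / 2 * w) * ((a + b) * (c - d))) =
  t * (1 + e / 2 * w) * (a * c) - t * (1 + e / 2 * w) * (a * d)
  + t * (1 + e / 2 * w) * (b * c) - t * (1 + e / 2 * w) * (b * d).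
Proof. by field. Qed.

Lemma coag_test_le a b c x y s : 0 <= s -> 0 < x -> 0 < y ->
  `|a| <= s * (1 + (x + y)) -> `|b| <= s * (1 + x) -> `|c| <= s * (1 + y) ->
  `|a - b - c| <= 3 * s * ((1 + x) * (1 + y)).
Proof.
move=> s0 x0 y0 ha hb hc.
have h1 : `|a - b - c| <= `|a| + `|b| + `|c|.
  by rewrite (le_trans (ler_normB _ _))// lerD2r ler_normB.
have h2 : 0 <= s * (x * y) by rewrite mulr_ge0// mulr_ge0 ?ltW.
have h3 : 0 <= s * x by rewrite mulr_ge0// ltW.
have h4 : 0 <= s * y by rewrite mulr_ge0// ltW.
have -> : 3 * s * ((1 + x) * (1 + y)) = 3 * s + 3 * (s * x) + 3 * (s * y) + 3 *
  (s * (x * y)).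
  by ring.
have e1 : s * (1 + (x + y)) = s + s * x + s * y by ring.
have e2 : s * (1 + x) = s + s * x by ring.
have e3 : s * (1 + y) = s + s * y by ring.
rewrite e1 in ha; rewrite e2 in hb; rewrite e3 in hc; lra.
Qed.

Lemma perturbation_le a b c d e s m n :
  a + e / 2 * b + (c + e * d) = 0 -> 0 <= e ->
  `|b| <= 3 * s * (m * n) -> `|d| <= 3 / 2 * s * n ->
  `|a + c| <= s * (e * (3 / 2 * (1 + m) * n)).
Proof.
move=> eq0 e0 hb hd.
have -> : a + c = - (e / 2 * b + e * d) by lra.
rewrite normrN (le_trans (ler_normD _ _))// !normrM (ger0_norm e0).
have -> : `|2^-1 : R| = 2^-1 by rewrite ger0_norm// invr_ge0.
have h1 : e / 2 * `|b| <= e / 2 * (3 * s * (m * n))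
  by rewrite ler_wpM2l// divr_ge0.
have h2 : e * `|d| <= e * (3 / 2 * s * n) by rewrite ler_wpM2l.
have -> : s * (e * (3 / 2 * (1 + m) * n)) =
   e / 2 * (3 * s * (m * n)) + e * (3 / 2 * s * n) by field.
exact: lerD.
Qed.

End difference_algebra.

(** * Difference of two solutions *)

Section difference.
Variable R : realType.
Local Notation mu := (@lebesgue_measure R).
Local Notation mu2 := (mu \x mu)%E.
Local Notation I1 := (Int mu).
Local Notation I2 := (Int mu2).
Implicit Types (a : R) (f phi : R -> R).

Variables (w v : R * R -> R) (eps rho : R) (q1 q2 : R -> R).
Hypotheses (kb : kernel_bounds w v) (wC : forall x y, w (x, y) = w (y, x)).
Hypotheses (eps0 : 0 <= eps).
Hypotheses (pq1 : profile rho q1) (wq1 : weak_solution w v eps q1).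
Hypotheses (pq2 : profile rho q2) (wq2 : weak_solution w v eps q2).

Let S x := q1 x + q2 x.
Let h x := q1 x - q2 x.

Lemma measurable_psum : measurable_fun setT S.
Proof. by apply: measurable_funD; [exact: pf_meas pq1|exact: pf_meas pq2]. Qed.

Lemma measurable_pdiff : measurable_fun setT h.
Proof. by apply: measurable_funB; [exact: pf_meas pq1|exact: pf_meas pq2]. Qed.

Lemma Rintegrable_psum : Rintegrable mu S.
Proof. exact: (RintegrableD (pf_summ pq1) (pf_summ pq2)). Qed.

Lemma Rintegrable_pdiff : Rintegrable mu h.
Proof. exact: (RintegrableB (pf_summ pq1) (pf_summ pq2)). Qed.

Lemma Rintegrablex_psum : Rintegrable mu (fun x => x * S x).
Proof.
rewrite (_ : (fun _ => _) = (fun x => x * q1 x + x * q2 x)).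
  exact: (RintegrableD (pf_summx pq1) (pf_summx pq2)).
by apply/funext => x; rewrite mulrDr.
Qed.

Lemma Rintegrablex_pdiff : Rintegrable mu (fun x => x * h x).
Proof.
rewrite (_ : (fun _ => _) = (fun x => x * q1 x - x * q2 x)).
  exact: (RintegrableB (pf_summx pq1) (pf_summx pq2)).
by apply/funext => x; rewrite mulrBr.
Qed.

Lemma psum_ge0 x : 0 <= S x.
Proof. by rewrite addr_ge0 ?(pf_ge0 pq1) ?(pf_ge0 pq2). Qed.

Lemma psum_le0 x : x <= 0 -> S x = 0.
Proof. by move=> x0; rewrite /S (pf_le0 pq1)// (pf_le0 pq2)// addr0. Qed.

Lemma pdiff_le0 x : x <= 0 -> h x = 0.
Proof. by move=> x0; rewrite /h (pf_le0 pq1)// (pf_le0 pq2)// subr0. Qed.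

Lemma mass_pdiff : I1 (fun x => x * h x) = 0.
Proof.
rewrite -[RHS](subrr rho) -{1}(pf_mass pq1) -(pf_mass pq2).
rewrite -(IntB (pf_summx pq1) (pf_summx pq2)).
by apply: (eq_Int mu) => x; rewrite mulrBr.
Qed.

Lemma Rintegrable1_psum : Rintegrable mu (fun x => (1 + x) * S x).
Proof.
rewrite (_ : (fun _ => _) = (fun x => S x + x * S x)).
  exact: (RintegrableD Rintegrable_psum Rintegrablex_psum).
by apply/funext => x; rewrite mulrDl mul1r.
Qed.

Lemma Rintegrablex_norm_pdiff : Rintegrable mu (fun x => x * `|h x|).
Proof.
rewrite (_ : (fun _ => _) = (fun x => `|x * h x|)).
  exact: (Rintegrable_norm Rintegrablex_pdiff).
apply/funext => x; have [x0|x0] := leP x 0.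
  by rewrite pdiff_le0// mulr0 normr0 mulr0.
by rewrite normrM (gtr0_norm x0).
Qed.

Lemma Rintegrable1_norm_pdiff : Rintegrable mu (fun x => (1 + x) * `|h x|).
Proof.
rewrite (_ : (fun _ => _) = (fun x => `|h x| + x * `|h x|)).
  exact: (RintegrableD (Rintegrable_norm Rintegrable_pdiff)
    Rintegrablex_norm_pdiff).
by apply/funext => x; rewrite mulrDl mul1r.
Qed.

(** [M] only ensures convergence; the estimate depends on the growth constant [s]. A truncation at
    [a] admits [s = a] as well as [s = 1], an indicator of [x > a] admits [s = (1 + a)^-1], and
    these choices produce the different error terms. *)
Lemma weak_diff phi (M s : R) : measurable_fun setT phi ->
  (forall x, `|phi x| <= M) -> 0 <= s ->
  (forall x, 0 < x -> `|phi x| <= s * (1 + x)) ->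
  `|I2 (fun p => (phi (p.1 + p.2) - phi p.1 - phi p.2) * (S p.1 * h p.2)) +
    I2 (fun p => (phi p.1 - phi p.2 / 2) * (2 * (tri p * h p.2)))| <=
  s * (eps * (3 / 2 * (1 + I1 (fun x => (1 + x) * S x)) *
              I1 (fun x => (1 + x) * `|h x|))).
Proof.
move=> mphi phiM s0 phis.
have sq1 := pf_summ pq1; have sq2 := pf_summ pq2.
have mT := measurable_coag_test mphi; have mF := measurable_frag_test mphi.
have nT p := coag_bounded p phiM; have nF p := frag_bounded p phiM.
set T := fun p : R * R => phi (p.1 + p.2) - phi p.1 - phi p.2.
set F := fun p : R * R => phi p.1 - phi p.2 / 2.
pose B p := T p * (1 + eps / 2 * w p).
have mB : measurable_fun setT B by apply: measurable_funM => //;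
  exact: measurable_coag kb.
have nB p : `|B p| <= (M + M + M) * (1 + eps).
  by rewrite normrM ler_pM//; [exact: nT|exact: norm_coag kb eps0 p].
have sB f g : Rintegrable mu f -> Rintegrable mu g -> Rintegrable mu2
  (fun p => B p * (f p.1 * g p.2)).
  by move=> sf sg; exact: (Rintegrable2_bprod mB nB sf sg).
(* By symmetry of [w] and of the increment of [phi] the mixed terms cancel, so that the difference
   of the two quadratic terms is exactly the bilinear form at [S] and [h]. *)
have BC : I2 (fun p => B p * (q1 p.1 * q2 p.2)) =
  I2 (fun p => B p * (q2 p.1 * q1 p.2)).
  rewrite -(I2_swap (sB _ _ sq1 sq2)); apply: (eq_Int mu2) => -[x y].
  by rewrite /B /T/= wC [y + x]addrC [q1 y * _]mulrC [_ - phi y - _]addrAC.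
have E1 : I2 (fun p => T p * ((1 + eps / 2 * w p) * (S p.1 * h p.2))) =
    I2 (fun p => T p * ((1 + eps / 2 * w p) * (q1 p.1 * q1 p.2))) -
    I2 (fun p => T p * ((1 + eps / 2 * w p) * (q2 p.1 * q2 p.2))).
  transitivity (I2 (fun p => B p * (q1 p.1 * q1 p.2)) - I2 (fun p => B p *
    (q1 p.1 * q2 p.2))
    + I2 (fun p => B p * (q2 p.1 * q1 p.2)) - I2 (fun p => B p * (q2 p.1 * q2
      p.2))).
    have s11 := sB _ _ sq1 sq1; have s12 := sB _ _ sq1 sq2.
    have s21 := sB _ _ sq2 sq1; have s22 := sB _ _ sq2 sq2.
    rewrite -(IntB s11 s12) -(IntD (RintegrableB s11 s12) s21).
    rewrite -(IntB (RintegrableD (RintegrableB s11 s12) s21) s22).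
    by apply: (eq_Int mu2) => p; exact: coag_bilinear.
  rewrite BC subrK; congr (_ - _); apply: (eq_Int mu2) => p;
    by rewrite /B -mulrA.
have sFq f : Rintegrable mu f -> measurable_fun setT f ->
  Rintegrable mu (fun x => x * f x) ->
    Rintegrable mu2 (fun p => F p * ((2 * tri p + eps * v p) * f p.2)).
  by move=> sf mf sxf; exact: (Rintegrable_bounded (m := mu2) mF nF
    (Rintegrable2_frag eps kb mf sf sxf)).
have E2 : I2 (fun p => F p * ((2 * tri p + eps * v p) * h p.2)) =
    I2 (fun p => F p * ((2 * tri p + eps * v p) * q1 p.2)) -
    I2 (fun p => F p * ((2 * tri p + eps * v p) * q2 p.2)).
  rewrite -(IntB (sFq _ sq1 (pf_meas pq1) (pf_summx pq1))
    (sFq _ sq2 (pf_meas pq2) (pf_summx pq2))).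
  by apply: (eq_Int mu2) => p; rewrite /h -!mulrBr.
have sSh := Rintegrable2_prod Rintegrable_psum Rintegrable_pdiff.
have sTSh : Rintegrable mu2 (fun p => T p * (S p.1 * h p.2))
  by exact: (Rintegrable_bounded (m := mu2) mT nT sSh).
have mTw : measurable_fun setT (fun p => T p * w p)
  by apply: measurable_funM => //; exact: kb_mw kb.
have nTw p : `|T p * w p| <= M + M + M.
  rewrite normrM (le_trans _ (nT p))// ler_piMr//.
  by have /andP[w0 w1] := kb_w kb p; rewrite ger0_norm.
have sTw : Rintegrable mu2 (fun p => T p * w p * (S p.1 * h p.2))
  by exact: (Rintegrable_bounded (m := mu2) mTw nTw sSh).
have sth := Rintegrable2_tri measurable_pdiff Rintegrablex_pdiff.
have svh := Rintegrable2_v kb measurable_pdiff Rintegrable_pdiff.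
have sFt : Rintegrable mu2 (fun p => F p * (2 * (tri p * h p.2)))
  by exact: (Rintegrable_bounded (m := mu2) mF nF (RintegrableZ 2 sth)).
have sFv : Rintegrable mu2 (fun p => F p * (v p * h p.2))
  by exact: (Rintegrable_bounded (m := mu2) mF nF svh).
have eq0 : I2 (fun p => T p * (S p.1 * h p.2)) +
    eps / 2 * I2 (fun p => T p * w p * (S p.1 * h p.2)) +
    (I2 (fun p => F p * (2 * (tri p * h p.2))) + eps * I2 (fun p => F p *
      (v p * h p.2))) = 0.
  rewrite -(IntZ _ sTw) -(IntD sTSh (RintegrableZ _ sTw)) -(IntZ _ sFv)
    -(IntD sFt (RintegrableZ _ sFv)).
  rewrite -[RHS](subrr (0 : R)) -{1}(wq1 mphi phiM) -(wq2 mphi phiM).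
  rewrite opprD addrACA -E1 -E2.
  by congr (_ + _); apply: (eq_Int mu2) => p; ring.
apply: (perturbation_le eq0 eps0).
- have sg : Rintegrable mu2 (fun p => 3 * s * (((1 + p.1) * S p.1) *
  ((1 + p.2) * `|h p.2|))).
    exact: (RintegrableZ _ (Rintegrable2_prod Rintegrable1_psum
      Rintegrable1_norm_pdiff)).
  rewrite -(I2_prod Rintegrable1_psum Rintegrable1_norm_pdiff).
  rewrite -(IntZ _ (Rintegrable2_prod Rintegrable1_psum
    Rintegrable1_norm_pdiff)).
  apply: (norm_Int sTw sg) => p /=.
  have [x0|x0] := leP p.1 0; first by rewrite psum_le0// !(mul0r,mulr0) normr0.
  have [y0|y0] := leP p.2 0; first by rewrite pdiff_le0// normr0 !mulr0 normr0.
  have /andP[w0 w1] := kb_w kb p.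
  rewrite -mulrA normrM !normrM (ger0_norm w0) (ger0_norm (psum_ge0 _)).
  have -> : 3 * s * ((1 + p.1) * S p.1 * ((1 + p.2) * `|h p.2|)) =
    3 * s * ((1 + p.1) * (1 + p.2)) * (S p.1 * `|h p.2|) by ring.
  rewrite ler_pM ?mulr_ge0 ?psum_ge0//.
    by apply: coag_test_le => //; apply: phis => //; exact: addr_gt0.
  by rewrite ler_piMl// mulr_ge0 ?psum_ge0.
- pose g x := (1 + x) * `|h x|.
  have mg : measurable_fun setT g
    by exact: Rintegrable_measurable Rintegrable1_norm_pdiff.
  have sg : Rintegrable mu g by exact: Rintegrable1_norm_pdiff.
  have g0 x : 0 <= g x.
    rewrite /g; have [x0|x0] := leP x 0; first
      by rewrite pdiff_le0// normr0 mulr0.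
    by rewrite mulr_ge0// addr_ge0// ltW.
  have gl0 x : x <= 0 -> g x = 0 by move=> x0; rewrite /g pdiff_le0// normr0
    mulr0.
  have svg := Rintegrable2_v kb mg sg.
  apply: (@le_trans _ _ (3 / 2 * s * I2 (fun p => v p * g p.2))); last first.
    by rewrite ler_wpM2l ?(I2_v_le kb mg sg)// mulr_ge0// divr_ge0.
  rewrite -(IntZ _ svg); apply: (norm_Int sFv (RintegrableZ _ svg)) => p.
  have /andP[v0 vt] := kb_v kb p.
  have [/andP[x0 xy]|out] := boolP ((0 < p.1) && (p.1 < p.2)); last first.
    have -> : v p = 0.
      apply/eqP; rewrite eq_le v0 andbT (le_trans vt)// /tri.
      by case: (0 < p.1) out; case: (p.1 < p.2) => //=
        _; rewrite ?(mul0r,mulr0).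
    by rewrite !(mul0r,mulr0) normr0.
  have y0 := lt_trans x0 xy.
  rewrite /g !normrM (ger0_norm v0).
  have -> : 3 / 2 * s * (v p * ((1 + p.2) * `|h p.2|)) =
    3 / 2 * s * (1 + p.2) * (v p * `|h p.2|) by ring.
  rewrite ler_wpM2r ?mulr_ge0//.
  have hx := phis _ x0; have hy := phis _ y0.
  (* A fragment is smaller than its parent, so [phi p.1] and [phi p.2 / 2] together cost
     [3 / 2 * s * (1 + p.2)]. *)
  have hxy : s * (1 + p.1) <= s * (1 + p.2) by rewrite ler_wpM2l// lerD2l ltW.
  rewrite (le_trans (ler_normB _ _))// normrM.
  have -> : `|2^-1 : R| = 2^-1 by rewrite ger0_norm// invr_ge0.
  by move: hx hy hxy; lra.
Qed.

End difference.

(** * A maximum principle and inequalities for the weight *)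

Section real_estimates.
Variable R : realType.
Implicit Types a b c d e k m n s t u v w x y z : R.

(* At a point far from 0 the loss [(s0 + a) |j a|] beats the gain [s0 * B] by a
   definite amount, and near 0 the function [j] is small, so the supremum of
   [|j|] cannot exceed [k]. *)
Lemma sup_decay (j : R -> R) (s0 k n0 n1 : R) : 0 <= s0 -> 0 <= k ->
  (forall a, 0 <= a -> `|j a| <= n1) -> (forall a, 0 <= a -> `|j a| <= a * n0)
    ->
  (forall B, (forall a, 0 <= a -> `|j a| <= B) ->
    forall a, 0 <= a -> (s0 + a) * `|j a| <= s0 * B + a * k) ->
  forall a, 0 <= a -> `|j a| <= k.
Proof.
move=> s00 k0 jn1 jn0 step a0 a00; rewrite leNgt; apply/negP => ka0.
pose E := [set `|j a| | a in [set a : R | 0 <= a]].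
have E0 : E !=set0 by exists `|j a0|; exists a0.
have ubE : has_ubound E by exists n1 => _ [a a_ge0 <-]; exact: jn1.
pose B := sup E.
have jB a : 0 <= a -> `|j a| <= B.
  by move=> a_ge0; apply: ub_le_sup => //; exists a.
have kB : k < B by exact: lt_le_trans ka0 (jB _ a00).
have B0 : 0 < B by exact: le_lt_trans kB.
have n00 : 0 <= n0 by have := jn0 _ ler01; rewrite mul1r; exact: le_trans.
(* On [[0, dl]] the linear bound already keeps [|j|] below [B / 2]. *)
pose dl := B / 2 / (n0 + 1).
have dl0 : 0 < dl by rewrite !divr_gt0//; lra.
have dln : dl * n0 <= B / 2.
  have e : dl * (n0 + 1) = B / 2 by rewrite divfK// gt_eqF//; lra.
  by move: e; rewrite mulrDr mulr1; lra.
(* Beyond [dl] the hypothesis gives [|j a| <= B - a * (B - k) / (s0 + a)]. Since [a / (s0 + a)]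
   increases, the gap is at least its value [th] at [dl]; the supremum need not be attained. *)
pose th := dl * (B - k) / (s0 + dl).
have sdl : 0 < s0 + dl by rewrite ltr_wpDl.
have Bk : 0 < B - k by rewrite subr_gt0.
have th0 : 0 < th by rewrite divr_gt0// mulr_gt0.
have thE : th * (s0 + dl) = dl * (B - k) by rewrite divfK// gt_eqF.
pose B' := Num.max (B / 2) (B - th).
have jB' a : 0 <= a -> `|j a| <= B'.
  move=> a_ge0; rewrite le_max; have [ad|da] := leP a dl.
    by rewrite (le_trans (jn0 _ a_ge0))// (le_trans _ dln)// ler_wpM2r.
  apply/orP; right; have sa : 0 < s0 + a by rewrite ltr_wpDl// (lt_trans dl0).
  rewrite -(ler_pM2l sa) (le_trans (step _ jB _ a_ge0))//.
  suff : (s0 + a) * th <= a * (B - k) by rewrite !(mulrBr, mulrDl); lra.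
  rewrite -(ler_pM2r sdl) -mulrA thE.
  have -> : a * (B - k) * (s0 + dl) = (a * (s0 + dl)) * (B - k) by ring.
  rewrite mulrA ler_pM2r// !mulrDr [(s0 + a) * dl]mulrDl [a * s0]mulrC lerD2r.
  by rewrite ler_wpM2l// ltW.
have : B <= B' by apply: ge_sup => // _ [a a_ge0 <-]; exact: jB'.
by rewrite /B' le_max => /orP[]; lra.
Qed.

(** The exact gap is [u / ((1 + t) * (1 + u + t))], and [1 + u + t <= (1 + u) * (1 + t)]. This bound
    has product form, so it factors under a double integral. *)
Lemma weight_add_le u t : 0 < u -> 0 < t ->
  weight (u + t) <= weight t - (u * weight u) * (weight t) ^+ 2.
Proof.
move=> u0 t0; rewrite (weightE (ltW u0)) (weightE (ltW t0))
  (weightE (ltW (addr_gt0 u0 t0))).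
have -> : (1 + t)^-1 - u * (1 + u)^-1 * ((1 + t)^-1) ^+ 2 =
  ((1 + t) * (1 + u) - u) / ((1 + u) * (1 + t) ^+ 2).
  by field; rewrite !gt_eqF//; lra.
rewrite ler_pdivlMr; last by rewrite mulr_gt0 ?exprn_gt0//; lra.
rewrite mulrC ler_pdivrMr; last lra.
have h : 0 <= u ^+ 2 * t * (1 + t) by rewrite !mulr_ge0 ?sqr_ge0//; lra.
have h2 : 0 <= u * t by rewrite mulr_ge0 ?ltW.
nra.
Qed.

(** The first term degenerates at [x = 0], where the second takes over. With [t = weight x] the
    claim reduces to [0 <= (1 - t) * (1 - c * (1 + t))], whence the condition [c <= 1 / 2]. *)
Lemma weight_coercive c s x y : 0 <= y -> 0 < x -> c <= 1 / 2 -> c <= s -> 0 <=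
  c ->
  c * y <= weight x * (x * y) + s * ((weight x) ^+ 2 * y).
Proof.
move=> y0 x0 c2 cs c0.
have -> : weight x * (x * y) + s * ((weight x) ^+ 2 * y) =
  (x * weight x + s * (weight x) ^+ 2) * y by ring.
rewrite ler_wpM2r//.
have wx : x * weight x = 1 - weight x.
  by rewrite weightE ?ltW//; field; rewrite gt_eqF//; lra.
have w0 := weight_gt0 x; have w1 := weight_le1 x.
rewrite wx; set t := weight x in w0 w1 *.
have h1 : c * t ^+ 2 <= s * t ^+ 2 by rewrite ler_wpM2r// sqr_ge0.
have h2 : 0 <= (1 - t) * (1 - c * (1 + t)).
  by rewrite mulr_ge0//; nra.
nra.
Qed.

Lemma tail_combine m x k z s : m + x <= k + z -> k <= m - s -> x + s <= z.
Proof. by move=> *; lra. Qed.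

Lemma norm_combine k m n a b c s t u w x y z :
  - (2 * k) <= a - b - s * (m + n) + (2 * t - (x + y)) ->
  a <= s * m + w -> - (2 * k) <= b -> t <= 2 * z -> w <= s * n - u -> c <=
    y + u ->
  x + c <= 4 * k + 4 * z.
Proof. by move=> *; lra. Qed.

End real_estimates.

(** * Coercivity of the linearized operator *)

Section weight_integrable.
Variable R : realType.
Local Notation mu := (@lebesgue_measure R).

(* Only the finiteness of its integral matters: it enters [eps_star]. *)
Definition tail_weight (a : R) : R := (0 < a)%R%:R * weight a ^+ 2.

(** Domination by the arctangent density, as [1 + x ^+ 2 <= (1 + x) ^+ 2] for [x >= 0]. *)
Lemma Rintegrable_tail_weight : Rintegrable mu tail_weight.
Proof.
have mone : measurable_fun setT (fun x : R => (oneDsqr x)^-1).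
  by apply: continuous_measurable_fun; exact: continuous_oneDsqrV.
have mD : measurable (`[0, +oo[%classic : set (measurableTypeR R))
  by exact: measurable_itv.
have ione : mu.-integrable `[0, +oo[%classic (EFin \o (fun x :
  R => (oneDsqr x)^-1)).
  apply/integrableP; split.
    by apply/measurable_EFinP; exact: measurable_funTS.
  rewrite (_ : (\int[_]_(_ in _) _)%E = (pi / 2)%:E) ?ltry//.
  rewrite -integral0y_oneDsqr; apply: eq_integral => x _ /=.
  by rewrite ger0_norm// invr_ge0 (le_trans ler01)// oneDsqr_ge1.
have sg : Rintegrable mu ((fun x : R => (oneDsqr x)^-1) \_ `[0, +oo[%classic).
  by move/(integrable_mkcond _ mD) : ione; rewrite restrict_EFin.
apply: (Rintegrable_le (m := mu) _ _ sg).
  apply: measurable_funM; first exact: measurable_ltr_nat.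
  by apply: measurable_funX; exact: measurable_weight.
move=> x; rewrite /tail_weight patchE mem_setE in_itv/= andbT.
have [x0|x0] := ltP 0 x; last first.
  by rewrite mul0r normr0; case: ifP => // _;
    rewrite invr_ge0 (le_trans ler01)// oneDsqr_ge1.
rewrite (ltW x0) mul1r ger0_norm ?sqr_ge0// (weightE (ltW x0)) exprVn lef_pV2.
- by rewrite /oneDsqr sqrrD expr1n mul1r addrAC lerDl mulrn_wge0// ltW.
- by rewrite posrE exprn_gt0// addr_gt0.
- by rewrite posrE (lt_le_trans ltr01)// oneDsqr_ge1.
Qed.

End weight_integrable.

Section coercivity.
Variable R : realType.
Local Notation mu := (@lebesgue_measure R).
Local Notation mu2 := (mu \x mu)%E.
Local Notation I1 := (Int mu).
Local Notation I2 := (Int mu2).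
Implicit Types (a t x : R) (f phi : R -> R).

Variables (S h : R -> R) (kap : R).
Hypotheses (mS : measurable_fun setT S) (S_ge0 : forall x, 0 <= S x)
  (S_le0 : forall x, x <= 0 -> S x = 0) (sS : Rintegrable mu S)
  (sxS : Rintegrable mu (fun x => x * S x)).
Hypotheses (mh : measurable_fun setT h) (h_le0 : forall x, x <= 0 -> h x = 0)
  (sh : Rintegrable mu h) (sxh : Rintegrable mu (fun x => x * h x))
  (h_mass : I1 (fun x => x * h x) = 0).

(** For [S = q1 + q2] this is the weak form of the unperturbed operator linearized at the midpoint
    of [q1] and [q2]; for a quadratic operator the midpoint linearization gives the difference
    exactly. *)
Definition linearized phi :=
  I2 (fun p => (phi (p.1 + p.2) - phi p.1 - phi p.2) * (S p.1 * h p.2)) +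
  I2 (fun p => (phi p.1 - phi p.2 / 2) * (2 * (tri p * h p.2))).

Hypothesis kap0 : 0 <= kap.
Hypothesis weak : forall phi (M s : R), measurable_fun setT phi ->
  (forall x, `|phi x| <= M) -> 0 <= s ->
  (forall x, 0 < x -> `|phi x| <= s * (1 + x)) -> `|linearized phi| <= s * kap.

(** Pairing the gain with the loss of the [S]-cluster leaves the increment [psi], needed only at
    positive sizes because [S] and [h] vanish elsewhere. *)
Lemma linearized_coag phi (M : R) (psi : R -> R -> R) : measurable_fun setT phi
  ->
  (forall x, `|phi x| <= M) ->
  (forall u v, 0 < u -> 0 < v -> phi (u + v) - phi u = psi u v) ->
  Rintegrable mu (fun u => S u * I1 (fun v => psi u v * h v)) /\
  I2 (fun p => (phi (p.1 + p.2) - phi p.1 - phi p.2) * (S p.1 * h p.2)) =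
  I1 (fun u => S u * I1 (fun v => psi u v * h v)) - I1 S * I1 (fun v => phi v *
    h v).
Proof.
move=> mphi phiM psiE.
have sphi : Rintegrable mu (fun v => phi v * h v)
  by exact: (Rintegrable_bounded (m := mu) mphi phiM sh).
have sP := Rintegrable2_prod sS sphi; have sSh := Rintegrable2_prod sS sh.
have mD : measurable_fun setT (fun p : R * R => phi (p.1 + p.2) - phi p.1).
  by apply: measurable_funB; [exact: measurable_comp_add|exact:
    measurable_comp_fst].
have nD (p : R * R) : `|phi (p.1 + p.2) - phi p.1| <= M + M.
  by rewrite (le_trans (ler_normB _ _))// lerD.
have sD : Rintegrable mu2 (fun p => (phi (p.1 + p.2) - phi p.1) *
  (S p.1 * h p.2)).
  exact: (Rintegrable_bounded (m := mu2) mD nD sSh).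
have E : (fun u => I1 (fun v => (phi (u + v) - phi u) * (S u * h v))) =
    (fun u => S u * I1 (fun v => psi u v * h v)).
  apply/funext => u; have [u0|u0] := leP u 0.
    rewrite S_le0// mul0r (@eq_Int _ _ _ mu _ (fun=> 0)) ?Int0// => v.
    by rewrite mul0r mulr0.
  have su : Rintegrable mu (fun v => (phi (u + v) - phi u) * h v).
    exact: (Rintegrable_bounded (m := mu) (measurable_fun_pair2 u mD)
      (fun v => nD (u, v)) sh).
  rewrite (@eq_Int _ _ _ mu _ (fun v => S u * ((phi (u + v) - phi u) * h v)));
    last first.
    by move=> v; rewrite mulrCA.
  rewrite (IntZ _ su); congr (_ * _); apply: (eq_Int mu) => v.
  by have [v0|v0] := leP v 0; [rewrite h_le0// !mulr0|rewrite psiE].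
split; first by rewrite -E; exact: (Rintegrable_iter1 sD).
rewrite -E -(I2_iter1 sD) -(I2_prod sS sphi) -(IntB sD sP).
by apply: (eq_Int mu2) => p; rewrite mulrBl [phi p.2 * (_ * _)]mulrCA.
Qed.

(* The test function 1; fragmentation does not contribute since [h] has zero
  mass. *)
Lemma number_diff_le : I1 S * `|I1 h| <= kap.
Proof.
have S0 : 0 <= I1 S by exact: Int_ge0.
have n1 (x : R) : `|1 : R| <= 1 by rewrite normr1.
have m1 : measurable_fun setT (fun _ : R => 1 : R) by exact: measurable_cst.
have := weak m1 n1 ler01; rewrite /linearized.
rewrite (I2_frag (Psi := fun v => v) m1 n1 mh sxh h_le0); last first.
  move=> v v0; rewrite -[RHS](I1_tri (ltW v0)); apply: (eq_Int mu) => y.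
  by rewrite mul1r.
have [_ ->] := linearized_coag (psi := fun _ _ => 0) m1 n1 (fun _ _ _ _ =>
  subrr _).
rewrite (@eq_Int _ _ _ mu (fun u => S u * _) (fun=> 0)); last first.
  move=> u; rewrite (@eq_Int _ _ _ mu _ (fun=> 0)) ?Int0 ?mulr0// => x.
  by rewrite mul0r.
rewrite Int0 (@eq_Int _ _ _ mu (fun v => 1 * h v) h); last
  by move=> x; rewrite mul1r.
rewrite (@eq_Int _ _ _ mu (fun v => (2 * v - v * 1) * h v) (fun x => x * h x));
  last first.
  by move=> x; ring.
rewrite h_mass addr0 sub0r normrN normrM (ger0_norm S0) mul1r; apply.
by move=> x x0; rewrite normr1 mul1r lerDl ltW.
Qed.

Let j a := I1 (fun v => trunc a v * h v).
Let H a := I1 (fun v => step a v * h v).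
Let S0 := I1 S.

Let S0_ge0 : 0 <= S0. Proof. exact: Int_ge0. Qed.

Let strunc a : 0 <= a -> Rintegrable mu (fun v => trunc a v * h v).
Proof.
move=> a0.
by apply: (Rintegrable_bounded (m := mu) (measurable_trunc a) _ sh) => x;
  exact: norm_trunc_le.
Qed.

Let sstep a : Rintegrable mu (fun v => step a v * h v).
Proof. exact: (Rintegrable_bounded (m := mu) (measurable_step a) (norm_step_le1
  a) sh). Qed.

(* By [h_mass], [- j a] is the second primitive of [h]: the integral over
   [x > a] of [H x]. *)
Lemma linearized_trunc a : 0 <= a ->
  Rintegrable mu (fun u => S u * j (Num.max (a - u) 0)) /\
  linearized (trunc a) =
  I1 (fun u => S u * j (Num.max (a - u) 0)) - S0 * j a - a * j a.
Proof.
move=> a0; have mt := measurable_trunc a; have nt x := norm_trunc_le x a0.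
have [sc Ec] := linearized_coag (psi := fun u => trunc (Num.max (a - u) 0)) mt
  nt
  (fun u v u0 v0 => trunc_shift a0 (ltW u0) (ltW v0)).
split; first exact: sc.
rewrite /linearized Ec; congr (_ + _).
rewrite (I2_frag mt nt mh sxh h_le0
  (fun v v0 => I1_tri_trunc a0 (ltW v0))).
rewrite (@eq_Int _ _ _ mu _ (fun v => a * (v * h v) - a * (trunc a v * h v)));
  last first.
  by move=> v; field.
rewrite (IntB (RintegrableZ _ sxh) (RintegrableZ _ (strunc a0))) (IntZ _ sxh)
  (IntZ _ (strunc a0)).
by rewrite h_mass mulr0 sub0r.
Qed.

Lemma linearized_step a : 0 <= a ->
  Rintegrable mu (fun u => S u * ((u <= a)%R%:R * H (a - u))) /\
  linearized (step a) =
  I1 (fun u => S u * ((u <= a)%R%:R * H (a - u))) - S0 * H a - (j a + a * H a).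
Proof.
move=> a0; have mt := measurable_step a; have nt := norm_step_le1 a.
have [sc Ec] := linearized_coag (psi := fun u v => (u <= a)%R%:R * step (a - u)
  v) mt nt
  (fun u v u0 v0 => step_shift a u v0).
have E : (fun u => S u * I1 (fun v => (u <= a)%R%:R * step (a - u) v * h v)) =
    (fun u => S u * ((u <= a)%R%:R * H (a - u))).
  apply/funext => u; congr (_ * _); rewrite -(IntZ _ (sstep _)).
  by apply: (eq_Int mu) => v; rewrite mulrA.
rewrite E in sc Ec; split; first exact: sc.
rewrite /linearized Ec; congr (_ + _).
rewrite (I2_frag mt nt mh sxh h_le0
  (fun v v0 => I1_tri_step v a0)).
rewrite (@eq_Int _ _ _ mu _ (fun v => v * h v - (trunc a v * h v + a *
  (step a v * h v)))).
  rewrite (IntB sxh (RintegrableD (strunc a0) (RintegrableZ _ (sstep a)))).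
  by rewrite (IntD (strunc a0) (RintegrableZ _ (sstep a))) (IntZ _ (sstep a))
    h_mass sub0r.
move=> v; have [v0|v0] := leP v 0; first
  by rewrite h_le0// !(mulr0, subr0, addr0).
rewrite /step /trunc (max_l (ltW v0)); have [av|va] := ltP a v.
  by rewrite max_l ?subr_ge0 ?ltW//= mulr1n; ring.
by rewrite max_r ?subr_le0//= mulr0n; ring.
Qed.

Lemma trunc_diff_le a : 0 <= a -> `|j a| <= kap.
Proof.
apply: (@sup_decay _ j S0 kap (I1 (fun x => `|h x|))
  (I1 (fun x => `|x * h x|))) => //.
- move=> b b0; apply: (norm_Int (strunc b0) (Rintegrable_norm sxh)) => x.
  have [x0|x0] := leP x 0; first by rewrite h_le0// !mulr0.
  by rewrite !normrM ler_wpM2r// (le_trans (norm_trunc_le_id b0 (ltW x0)))//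
    ler_norm.
- move=> b b0; rewrite -(IntZ _ (Rintegrable_norm sh)).
  apply: (norm_Int (strunc b0) (RintegrableZ _ (Rintegrable_norm sh))) => x.
  by rewrite normrM ler_wpM2r// norm_trunc_le.
move=> B jB b b0; have [sc Ec] := linearized_trunc b0.
(* The choice [s = b] makes the error vanish at 0 at the same rate as the damping, as [sup_decay]
   requires. *)
have ws : `|linearized (trunc b)| <= b * kap.
  apply: (weak (measurable_trunc b) (fun x => norm_trunc_le x b0) b0) => x x0.
  by rewrite (le_trans (norm_trunc_le x b0))// ler_peMr// lerDl ltW.
have cB : `|I1 (fun u => S u * j (Num.max (b - u) 0))| <= S0 * B.
  rewrite mulrC -(IntZ _ sS); apply: (norm_Int sc (RintegrableZ _ sS)) => u.
  by rewrite normrM mulrC (ger0_norm (S_ge0 u)) ler_wpM2r// jB// le_max lexx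
    orbT.
have -> : (S0 + b) * `|j b| = `|(S0 + b) * j b|.
  by rewrite normrM ger0_norm// addr_ge0.
have -> : (S0 + b) * j b = I1 (fun u => S u * j (Num.max (b - u) 0)) -
  linearized (trunc b).
  by rewrite Ec; ring.
by rewrite (le_trans (ler_normB _ _))// lerD.
Qed.

(** For large [a] the choice [s = 1] is better: the error no longer grows while the damping does.
    Adding [trunc_diff_le] turns the factor [a] into [1 + a]. *)
Lemma trunc_diff_decay a : 0 <= a -> `|j a| <= (2 + S0) * kap * weight a.
Proof.
move=> a0; rewrite weightE// ler_pdivlMr; last lra.
have [sc Ec] := linearized_trunc a0.
have ws : `|linearized (trunc a)| <= 1 * kap.
  apply: (weak (measurable_trunc a) (fun x => norm_trunc_le x a0) ler01) => x
    x0.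
  by rewrite (le_trans (norm_trunc_le_id a0 (ltW x0)))// mul1r lerDr.
have cB : `|I1 (fun u => S u * j (Num.max (a - u) 0))| <= S0 * kap.
  rewrite mulrC -(IntZ _ sS); apply: (norm_Int sc (RintegrableZ _ sS)) => u.
  rewrite normrM mulrC (ger0_norm (S_ge0 u)) ler_wpM2r//.
  by rewrite trunc_diff_le// le_max lexx orbT.
have h1 : (S0 + a) * `|j a| <= S0 * kap + kap.
  have -> : (S0 + a) * `|j a| = `|(S0 + a) * j a|.
    by rewrite normrM ger0_norm// addr_ge0.
  have -> : (S0 + a) * j a = I1 (fun u => S u * j (Num.max (a - u) 0)) -
    linearized (trunc a).
    by rewrite Ec; ring.
  by rewrite (le_trans (ler_normB _ _))// lerD// -[leRHS]mul1r.
have h2 := trunc_diff_le a0.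
have h3 : 0 <= S0 * `|j a| by rewrite mulr_ge0.
by move: h1 h2 h3; rewrite mulrDl mulrDr mulr1 [`|j a| * a]mulrC mulrDl; lra.
Qed.


Let sigma := I1 (fun x => x * weight x * S x).

Let ssigma := Rintegrable_weight_moment sxS.

Let norm_weight2 x : `|weight x ^+ 2| <= 1 :> R.
Proof. by rewrite normrX; apply: exprn_ile1; [exact: normr_ge0|exact:
  norm_weight]. Qed.

Let mweight2 : measurable_fun setT (fun x : R => weight x ^+ 2).
Proof. by apply: measurable_funX; exact: measurable_weight. Qed.

Lemma Rintegrable_weight_id f : measurable_fun setT f -> Rintegrable mu f ->
  (forall x, x <= 0 -> f x = 0) -> Rintegrable mu (fun x => weight x *
    (x * f x)).
Proof.
move=> mf sf f0; apply: (Rintegrable_le (m := mu) _ _ (Rintegrable_norm sf)).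
  by apply: measurable_funM; [exact: measurable_weight|exact: measurable_funM].
move=> x; have [x0|x0] := leP x 0; first by rewrite f0// !mulr0.
rewrite mulrA normrM ler_piMl//.
have w0 := weight_gt0 x.
have wx : weight x * (1 + x) = 1
  by rewrite (weightE (ltW x0)) mulVf// gt_eqF//; lra.
have wx0 : 0 <= weight x * x by rewrite mulr_ge0 ?ltW.
by rewrite (ger0_norm wx0); move: wx; rewrite mulrDr mulr1; lra.
Qed.

Section weighted_convolution.
Variable f : R -> R.
Hypotheses (sf : Rintegrable mu f) (f_ge0 : forall x, 0 <= f x)
  (f_le0 : forall x, x <= 0 -> f x = 0).

Lemma Rintegrable_weight1 : Rintegrable mu (fun x => weight x * f x).
Proof. exact: (Rintegrable_bounded (m := mu) (@measurable_weight R)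
  (@norm_weight R) sf). Qed.

Lemma Rintegrable_weight2 : Rintegrable mu (fun x => weight x ^+ 2 * f x).
Proof. exact: (Rintegrable_bounded (m := mu) mweight2 norm_weight2 sf). Qed.

Lemma Rintegrable_weight_conv : Rintegrable mu2 (fun p => weight (p.1 + p.2) *
  (S p.1 * f p.2)).
Proof.
exact: (Rintegrable_bounded (m := mu2) (measurable_comp_add (@measurable_weight
  R))
  (fun p => norm_weight _) (Rintegrable2_prod sS sf)).
Qed.

(** The first term on the right is the coagulation loss, to be cancelled; the defect carrying
    [sigma] is the coercivity that coagulation supplies near 0. *)
Lemma weight_conv_le : I2 (fun p => weight (p.1 + p.2) * (S p.1 * f p.2)) <=
  S0 * I1 (fun x => weight x * f x) - sigma * I1 (fun x => weight x ^+ 2 * f x).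
Proof.
rewrite -(I2_prod sS Rintegrable_weight1) -(I2_prod ssigma Rintegrable_weight2).
have s1 := Rintegrable2_prod sS Rintegrable_weight1; have s2 :=
  Rintegrable2_prod ssigma Rintegrable_weight2.
rewrite -(IntB s1 s2); apply: (le_Int Rintegrable_weight_conv (RintegrableB s1
  s2)) => p.
have [x0|x0] := leP p.1 0; first by rewrite S_le0// !(mul0r, mulr0) subr0.
have [y0|y0] := leP p.2 0; first by rewrite f_le0// !mulr0 subr0.
have := ler_wpM2r (mulr_ge0 (S_ge0 p.1) (f_ge0 p.2)) (weight_add_le x0 y0).
by move/le_trans; apply; rewrite le_eqVlt; apply/orP; left; apply/eqP; ring.
Qed.

Lemma weight_coercive_Int (c : R) : 0 <= c -> c <= 1 / 2 -> c <= sigma ->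
  measurable_fun setT f ->
  c * I1 f <= I1 (fun x => weight x * (x * f x)) +
              sigma * I1 (fun x => weight x ^+ 2 * f x).
Proof.
move=> c0 c2 cs mf; have s3 := Rintegrable_weight_id mf sf f_le0.
rewrite -(IntZ _ sf) -(IntZ _ Rintegrable_weight2) -(IntD s3 (RintegrableZ _
  Rintegrable_weight2)).
apply: (le_Int (RintegrableZ _ sf) (RintegrableD s3 (RintegrableZ _
  Rintegrable_weight2))) => x.
have [x0|x0] := leP x 0; first by rewrite f_le0// !mulr0 addr0.
exact: weight_coercive.
Qed.

End weighted_convolution.

(** [H] is constant on the negative axis, so it is cut off there: the result is integrable by the
    first moment of [h], and its convolution with [S] runs over the whole line. *)
Definition tail_mass t := I1 (fun v => tri (t, v) * h v).

Lemma Rintegrable_tail_mass : Rintegrable mu tail_mass.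
Proof. exact: (Rintegrable_iter1 (Rintegrable2_tri mh sxh)). Qed.

Lemma tail_mass_le0 t : t <= 0 -> tail_mass t = 0.
Proof.
move=> t0; rewrite /tail_mass (@eq_Int _ _ _ mu _ (fun=> 0)) ?Int0// => x.
by rewrite /tri/= ltNge t0 !mul0r.
Qed.

Let tail_massE t : 0 < t -> tail_mass t = H t.
Proof.
by move=> t0; apply: (eq_Int mu) => x; rewrite /tri/= t0 mul1r.
Qed.

Let mtail : measurable_fun setT tail_mass.
Proof. exact: Rintegrable_measurable Rintegrable_tail_mass. Qed.

Lemma ae_neq (a : R) : {ae mu, forall u, u != a}.
Proof.
exists [set a]; split=> //; first by rewrite lebesgue_measure_set1.
by move=> u /= /negP; rewrite negbK => /eqP.
Qed.

(* [tail_mass] vanishes on [t <= 0], so its convolution with [S] differs from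
   the one of [linearized_step] at the single point [u = a]. *)
Lemma tail_mass_le a : 0 < a ->
  weight a * ((S0 + a) * `|tail_mass a|) <=
  I1 (fun u => weight a * (S u * `|tail_mass (a - u)|)) +
  (3 + S0) * kap * weight a ^+ 2.
Proof.
move=> a0; have [sc Ec] := linearized_step (ltW a0).
have w0 := ltW (weight_gt0 a).
have -> : I1 (fun u => weight a * (S u * `|tail_mass (a - u)|)) =
    weight a * I1 (fun u => `|S u * ((u <= a)%R%:R * H (a - u))|).
  rewrite -(IntZ _ (Rintegrable_norm sc)); apply: (ae_eq_Int (m := mu)).
  - apply: measurable_funM => //; apply: measurable_funM => //.
    apply: measurableT_comp => //; apply: (measurableT_comp mtail).
    exact: measurable_funB.
  - exact: Rintegrable_measurable (RintegrableZ _ (Rintegrable_norm sc)).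
  - apply: (ae_mono (m := mu) (ae_neq a)) => u ua.
    rewrite normrM (ger0_norm (S_ge0 u)); congr (_ * (_ * `|_|)).
    have [lt_ua|lt_au|/eqP] := ltgtP u a; last by rewrite (negbTE ua).
      by rewrite tail_massE ?subr_gt0// mulr1n mul1r.
    by rewrite tail_mass_le0 ?subr_le0 ?ltW// mulr0n mul0r.
have ws : `|linearized (step a)| <= (1 + a)^-1 * kap.
  apply: (weak (measurable_step a) (norm_step_le1 a)).
    by rewrite invr_ge0; lra.
  by move=> x x0; apply: norm_step_le; exact: ltW.
rewrite -(weightE (ltW a0)) in ws.
have jd := trunc_diff_decay (ltW a0).
(* The share [2 + S0] comes from the source [j a], the remaining 1 from the perturbation. *)
have -> : (3 + S0) * kap * weight a ^+ 2 =
    weight a * ((2 + S0) * kap * weight a + weight a * kap) by ring.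
rewrite -mulrDr ler_wpM2l// tail_massE//.
have -> : (S0 + a) * `|H a| = `|(S0 + a) * H a|.
  by rewrite normrM (ger0_norm (_ : 0 <= S0 + a))// addr_ge0// ltW.
have -> : (S0 + a) * H a = I1 (fun u => S u * ((u <= a)%R%:R * H (a - u))) -
    (j a + linearized (step a)) by rewrite Ec; ring.
rewrite (le_trans (ler_normB _ _))// lerD//.
  exact: (norm_Int sc (Rintegrable_norm sc)).
by rewrite (le_trans (ler_normD _ _))// lerD.
Qed.


(** After integration of [tail_mass_le] over [a], the terms with [S0] cancel against
    [weight_conv_le], and what remains is the left side of the coercivity estimate. *)
Lemma tail_mass_Int_le (c : R) : 0 <= c -> c <= 1 / 2 -> c <= sigma ->
  c * I1 (fun x => `|tail_mass x|) <= (3 + S0) * kap * I1 (@tail_weight R).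
Proof.
move=> c0 c2 cs; pose f x := `|tail_mass x|.
have sf : Rintegrable mu f by exact: (Rintegrable_norm Rintegrable_tail_mass).
have mf : measurable_fun setT f by exact: Rintegrable_measurable sf.
have f_ge0 x : 0 <= f x by exact: normr_ge0.
have f_le0 x : x <= 0 -> f x = 0 by move=> x0; rewrite /f tail_mass_le0//
  normr0.
apply: (le_trans (weight_coercive_Int sf f_ge0 f_le0 c0 c2 cs mf)).
have s1 := Rintegrable_weight1 sf; have s3 := Rintegrable_weight_id mf sf f_le0.
have sK := Rintegrable_weight_conv sf; have sKs := Rintegrable2_shear (-1) sK.
have sz := RintegrableZ ((3 + S0) * kap) (@Rintegrable_tail_weight R).
have key : S0 * I1 (fun x => weight x * f x) + I1 (fun x => weight x *
  (x * f x)) <=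
    I2 (fun p => weight (p.1 + p.2) * (S p.1 * f p.2)) +
    (3 + S0) * kap * I1 (@tail_weight R).
  (* The shear substitutes [a - u] for the second variable, so that [weight (p.1 + p.2)] becomes
     [weight a]. *)
  rewrite -(I2_shear (-1) sK) (I2_iter2 sKs) -(IntZ _ s1)
    -(IntD (RintegrableZ _ s1) s3).
  rewrite -(IntZ _ (@Rintegrable_tail_weight R)) -(IntD (Rintegrable_iter2 sKs)
    sz).
  apply: (le_Int (RintegrableD (RintegrableZ _ s1) s3) (RintegrableD
    (Rintegrable_iter2 sKs) sz)) => a /=.
  have [a0|a0] := leP a 0.
    rewrite f_le0// !mulr0 addr0 /tail_weight ltNge a0 mul0r mulr0 addr0.
    by apply: Int_ge0 => u; rewrite !mulr_ge0 ?S_ge0// ltW// weight_gt0.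
  rewrite /tail_weight a0 mul1r.
  have := tail_mass_le a0; rewrite mulrDl mulrDr -!/(f _).
  rewrite (@eq_Int _ _ _ mu (fun u => weight a * _)
    (fun u => weight (u + (a + -1 * u)) * (S u * f (a + -1 * u)))); last first.
    by move=> u; rewrite mulN1r subrKC.
  by rewrite [weight a * (S0 * _)]mulrCA.
exact: (tail_combine key (weight_conv_le sf f_ge0 f_le0)).
Qed.

Let sgn x : R := (0 < h x)%R%:R - (h x < 0)%R%:R.

Let sgnE x : sgn x * h x = `|h x|.
Proof.
rewrite /sgn; have [h0|h0|->] := ltgtP (h x) 0.
- by rewrite ltr0_norm// mulr0n mulr1n sub0r mulN1r.
- by rewrite gtr0_norm// mulr0n mulr1n subr0 mul1r.
- by rewrite mulr0 normr0.
Qed.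

Let norm_sgn x : `|sgn x| <= 1.
Proof.
rewrite /sgn; have [h0|h0|h0] := ltgtP (h x) 0.
- by rewrite mulr0n mulr1n sub0r normrN1.
- by rewrite mulr0n mulr1n subr0 normr1.
- by rewrite mulr0n subrr normr0.
Qed.

Let msgn : measurable_fun setT sgn.
Proof. by apply: measurable_funB; exact: measurable_ltr_nat. Qed.

(* The test function is [(1 + weight) * sgn h]. *)
Lemma pdiff_Int_le (c : R) : 0 <= c -> c <= 1 / 2 -> c <= sigma ->
  I1 (fun x => x * `|h x|) + c * I1 (fun x => `|h x|) <=
  4 * kap + 4 * I1 (fun x => `|tail_mass x|).
Proof.
move=> c0 c2 cs; pose f x := `|h x|.
have sf : Rintegrable mu f by exact: (Rintegrable_norm sh).
have mf : measurable_fun setT f by exact: Rintegrable_measurable sf.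
have f_ge0 x : 0 <= f x by exact: normr_ge0.
have f_le0 x : x <= 0 -> f x = 0 by move=> x0; rewrite /f h_le0// normr0.
pose phi x := (1 + weight x) * sgn x.
have w1 x : 0 <= 1 + weight x :> R by rewrite addr_ge0// ltW// weight_gt0.
have w2 x : 1 + weight x <= 2 :> R by have := weight_le1 x; lra.
have nphiw x : `|phi x| <= 1 + weight x.
  by rewrite /phi normrM (ger0_norm (w1 x)) ler_piMr.
have nphi x : `|phi x| <= 2 by exact: le_trans (nphiw x) (w2 x).
have mphi : measurable_fun setT phi.
  by apply: measurable_funM => //; apply: measurable_funD => //;
    exact: measurable_weight.
have phih x : phi x * h x = (1 + weight x) * f x by rewrite /phi -mulrA sgnE.
have sphih : Rintegrable mu (fun x => phi x * h x)
  by exact: (Rintegrable_bounded (m := mu) mphi nphi sh).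
have sphiS : Rintegrable mu (fun x => phi x * S x)
  by exact: (Rintegrable_bounded (m := mu) mphi nphi sS).
have s1 := Rintegrable_weight1 sf; have s3 := Rintegrable_weight_id mf sf f_le0.
have sxf : Rintegrable mu (fun x => x * f x).
  rewrite (_ : (fun _ => _) = (fun x => `|x * h x|)); first exact:
    (Rintegrable_norm sxh).
  apply/funext => x; have [x0|x0] := leP x 0.
    by rewrite f_le0// h_le0// !mulr0 normr0.
  by rewrite normrM (gtr0_norm x0).
have low : - (2 * kap) <= linearized phi.
  have : `|linearized phi| <= 2 * kap.
    apply: (weak mphi nphi) => // x x0; rewrite (le_trans (nphi x))//.
    by rewrite ler_peMr// lerDl ltW.
  by rewrite ler_norml => /andP[].
have sSh := Rintegrable2_prod sS sh; have sSf := Rintegrable2_prod sS sf.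
have sK := Rintegrable_weight_conv sf.
have sP : Rintegrable mu2 (fun p => phi (p.1 + p.2) * (S p.1 * h p.2)).
  exact: (Rintegrable_bounded (m := mu2) (measurable_comp_add mphi)
    (fun p => nphi _) sSh).
have sA := Rintegrable2_prod sphiS sh; have sB := Rintegrable2_prod sS sphih.
have E1 : I2 (fun p => (phi (p.1 + p.2) - phi p.1 - phi p.2) * (S p.1 * h p.2))
  =
    I2 (fun p => phi (p.1 + p.2) * (S p.1 * h p.2)) -
    I1 (fun x => phi x * S x) * I1 h - S0 * I1 (fun x => phi x * h x).
  rewrite -(I2_prod sphiS sh) -(I2_prod sS sphih) -(IntB sP sA)
    -(IntB (RintegrableB sP sA) sB).
  by apply: (eq_Int mu2) => p; ring.
have P_le : I2 (fun p => phi (p.1 + p.2) * (S p.1 * h p.2)) <=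
    S0 * I1 f + I2 (fun p => weight (p.1 + p.2) * (S p.1 * f p.2)).
  rewrite -(I2_prod sS sf) -(IntD sSf sK);
    apply: (le_Int sP (RintegrableD sSf sK)) => p.
  rewrite (le_trans (ler_norm _))// normrM [`|S _ * _|]normrM
    (ger0_norm (S_ge0 _)).
  have := ler_wpM2r (mulr_ge0 (S_ge0 p.1) (f_ge0 p.2)) (nphiw (p.1 + p.2)).
  by rewrite mulrDl mul1r.
(* This term has no sign, but it contains [h] only through [I1 h], and [I1 S * |I1 h|] is already of
   order [kap]. *)
have A_le : - (2 * kap) <= I1 (fun x => phi x * S x) * I1 h.
  have : `|I1 (fun x => phi x * S x) * I1 h| <= 2 * kap.
    rewrite normrM (le_trans _ (ler_wpM2l _ number_diff_le))// mulrA
      ler_wpM2r//.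
    rewrite -(IntZ _ sS); apply: (norm_Int sphiS (RintegrableZ _ sS)) => x.
    by rewrite normrM (ger0_norm (S_ge0 x)) ler_wpM2r.
  by rewrite ler_norml => /andP[].
have phihE : I1 (fun x => phi x * h x) = I1 f + I1 (fun x => weight x * f x).
  rewrite -(IntD sf s1); apply: (eq_Int mu) => x.
  by rewrite phih mulrDl mul1r.
have sth := Rintegrable2_tri mh sxh.
have st1 : Rintegrable mu2 (fun p => phi p.1 * (tri p * h p.2)).
  exact: (Rintegrable_bounded (m := mu2) (measurable_comp_fst mphi)
    (fun p => nphi _) sth).
have sxph : Rintegrable mu (fun x => x * (phi x * h x)).
  rewrite (_ : (fun _ => _) = (fun x => phi x * (x * h x))).
    exact: (Rintegrable_bounded (m := mu) mphi nphi sxh).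
  by apply/funext => x; rewrite mulrCA.
have mph : measurable_fun setT (fun x => phi x * h x)
  by exact: Rintegrable_measurable sphih.
have st2 := Rintegrable2_tri mph sxph.
(* Integrating out the parent turns the gain into [tail_mass] with its cancellations intact; in the
   loss, [phi x * h x] is nonnegative. *)
have E2 : I2 (fun p => (phi p.1 - phi p.2 / 2) * (2 * (tri p * h p.2))) =
    2 * I1 (fun x => phi x * tail_mass x) - (I1 (fun x => x * f x) +
      I1 (fun x => weight x * (x * f x))).
  rewrite (I2_mul_fst mphi nphi sth) -(IntD sxf s3).
  rewrite (@eq_Int _ _ _ mu (fun x => x * f x + weight x * (x * f x))
    (fun x => x * (phi x * h x))); last by move=> x; rewrite phih; ring.
  rewrite -(I2_tri mph sxph) -?(IntZ _ st1) -?(IntB (RintegrableZ _ st1) st2).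
    by apply: (eq_Int mu2) => p; field.
  by move=> x x0; rewrite h_le0// mulr0.
have T_le : I1 (fun x => phi x * tail_mass x) <=
  2 * I1 (fun x => `|tail_mass x|).
  have st := Rintegrable_norm Rintegrable_tail_mass.
  have spt : Rintegrable mu (fun x => phi x * tail_mass x).
    exact: (Rintegrable_bounded (m := mu) mphi nphi Rintegrable_tail_mass).
  rewrite -(IntZ _ st); apply: (le_Int spt (RintegrableZ _ st)) => x.
  by rewrite (le_trans (ler_norm _))// normrM ler_wpM2r.
have conv := weight_conv_le sf f_ge0 f_le0.
have coer := weight_coercive_Int sf f_ge0 f_le0 c0 c2 cs mf.
move: low; rewrite /linearized E1 E2 phihE => low.
exact: (norm_combine low P_le A_le T_le conv coer).
Qed.

End coercivity.

(** * Uniqueness *)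

Section smallness.
Variable R : realType.
Implicit Types c e k m n r s t x y z : R.

(** Here [n] is the weighted norm of [h], and both it and [t] are controlled only up to a factor
    [c], which accounts for [c ^+ 2]. Since [k] is proportional to [e * n], a nonzero [n] can be
    divided out, contradicting the smallness of [e]. *)
Lemma smallness_threshold r z c e m s n x y t k : 0 < r -> 0 <= z ->
  0 <= c -> c <= 1 -> 0 < e ->
  e * (3 / 2 * (4 * r + 3) * (4 + 4 * (2 * r + 5) * z) + 1) < c ^+ 2 ->
  m <= 4 * r + 2 -> s <= 2 * r + 2 -> 0 <= m -> 0 <= s -> 0 <= x -> 0 <= y ->
  n = x + y -> k = e * (3 / 2 * (1 + m) * n) ->
  y + c * x <= 4 * k + 4 * t -> c * t <= (3 + s) * k * z -> n = 0.
Proof.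
move=> r0 z0 c0 c1 e0 small hm hs m0 s0 x0 y0 nE kE h1 h2.
have n0 : 0 <= n by rewrite nE addr_ge0.
pose A := 3 / 2 * (1 + m); pose B := 4 + 4 * (3 + s) * z.
pose A' := 3 / 2 * (4 * r + 3); pose B' := 4 + 4 * (2 * r + 5) * z.
have A0 : 0 <= A by rewrite /A mulr_ge0 ?addr_ge0 ?divr_ge0.
have AA : A <= A' by rewrite /A /A' ler_wpM2l ?divr_ge0//; lra.
have BB : B <= B'.
  by rewrite /B /B' lerD2l ler_wpM2r// ler_wpM2l//; lra.
have B0 : 0 <= B by rewrite /B addr_ge0 ?mulr_ge0 ?addr_ge0.
have k0 : 0 <= k by rewrite kE -/A (mulr_ge0 (ltW e0))// mulr_ge0.
have cn : c * n <= y + c * x.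
  by rewrite nE mulrDr addrC lerD2r ler_piMl.
have ccn : c ^+ 2 * n <= k * B.
  have h3 : c * (c * n) <= c * (4 * k + 4 * t).
    by rewrite ler_wpM2l// (le_trans cn).
  have h4 : c * k <= k by rewrite ler_piMl.
  have -> : c ^+ 2 * n = c * (c * n) by ring.
  apply: (le_trans h3).
  have -> : c * (4 * k + 4 * t) = 4 * (c * k) + 4 * (c * t) by ring.
  have -> : k * B = 4 * k + 4 * ((3 + s) * k * z) by rewrite /B; ring.
  lra.
have kB : k * B <= e * (A' * B') * n.
  have -> : k * B = e * n * (A * B) by rewrite kE /A; ring.
  have -> : e * (A' * B') * n = e * n * (A' * B') by ring.
  by rewrite ler_wpM2l ?mulr_ge0 ?(ltW e0)// ler_pM.
apply/eqP; rewrite eq_le n0 andbT leNgt; apply/negP => n_gt0.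
have : c ^+ 2 * n <= e * (A' * B') * n by exact: le_trans kB.
rewrite ler_pM2r// => h.
have h5 : e * (A' * B' + 1) < c ^+ 2 by exact: small.
rewrite mulrDr mulr1 in h5; lra.
Qed.

Lemma add_bounds x y r : x <= r + 1 -> y <= r + 1 -> x + y <= 2 * r + 2.
Proof. by move=> *; lra. Qed.

Lemma moment_bound x r : x <= 2 * r + 2 -> x + 2 * r <= 4 * r + 2.
Proof. by move=> *; lra. Qed.

Lemma ratio_le_half r : 0 < r -> r / (3 * r + 8) <= 1 / 2.
Proof. by move=> r0; rewrite ler_pdivrMr; lra. Qed.

End smallness.

Section uniqueness.
Variable R : realType.
Local Notation mu := (@lebesgue_measure R).
Local Notation mu2 := (mu \x mu)%E.
Local Notation I1 := (Int mu).
Local Notation I2 := (Int mu2).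

Variables (w v : R * R -> R) (eps rho : R) (q1 q2 : R -> R).
Hypotheses (kb : kernel_bounds w v) (wC : forall x y, w (x, y) = w (y, x)).
Hypotheses (eps0 : 0 < eps) (eps1 : eps <= 1) (rho0 : 0 < rho).
Hypotheses (pq1 : profile rho q1) (wq1 : weak_solution w v eps q1).
Hypotheses (pq2 : profile rho q2) (wq2 : weak_solution w v eps q2).

Let S x := q1 x + q2 x.
Let h x := q1 x - q2 x.
Let N := I1 (fun x => (1 + x) * `|h x|).
Let m := I1 (fun x => (1 + x) * S x).
Let kap := eps * (3 / 2 * (1 + m) * N).
Local Notation Z := (I1 (@tail_weight R)).
Local Notation c := (rho / (3 * rho + 8)).

Lemma weak_uniqueness :
  eps * (3 / 2 * (4 * rho + 3) * (4 + 4 * (2 * rho + 5) * Z) + 1) < c ^+ 2 ->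
  {ae mu, forall x, q1 x = q2 x}.
Proof.
move=> small; have eps_ge0 := ltW eps0.
have sS := Rintegrable_psum pq1 pq2; have sxS := Rintegrablex_psum pq1 pq2.
have sh := Rintegrable_pdiff pq1 pq2; have sxh := Rintegrablex_pdiff pq1 pq2.
have sxnh := Rintegrablex_norm_pdiff pq1 pq2; have snh := Rintegrable_norm sh.
have S_ge0 := psum_ge0 pq1 pq2; have S_le0 := psum_le0 pq1 pq2.
have h_le0 := pdiff_le0 pq1 pq2.
have NE : N = I1 (fun x => `|h x|) + I1 (fun x => x * `|h x|).
  rewrite -(IntD snh sxnh); apply: (eq_Int mu) => x; by rewrite mulrDl mul1r.
have mE : m = I1 S + 2 * rho.
  transitivity (I1 S + I1 (fun x => x * S x)).
    rewrite -(IntD sS sxS); apply: (eq_Int mu) => x; by rewrite mulrDl mul1r.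
  congr (_ + _); rewrite -{1}[rho](pf_mass pq1) mulr_natl mulr2n.
  rewrite {2}(pf_mass pq1) -(pf_mass pq2) -(IntD (pf_summx pq1) (pf_summx pq2)).
  by apply: (eq_Int mu) => x; rewrite mulrDr.
have S0E : I1 S = I1 q1 + I1 q2 by rewrite -(IntD (pf_summ pq1) (pf_summ pq2)).
have n1 := number_le kb eps_ge0 eps1 rho0 pq1 wq1.
have n2 := number_le kb eps_ge0 eps1 rho0 pq2 wq2.
have S0_ge0 : 0 <= I1 S by apply: Int_ge0.
have S0_le : I1 S <= 2 * rho + 2 by rewrite S0E; exact: add_bounds.
have m_le : m <= 4 * rho + 2 by rewrite mE; exact: moment_bound.
have m_ge0 : 0 <= m by rewrite mE addr_ge0// mulr_ge0// ltW.
have x0 : 0 <= I1 (fun x => `|h x|) by exact: Int_ge0.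
have y0 : 0 <= I1 (fun x => x * `|h x|).
  apply: Int_ge0 => x; have [xl|xg] := leP x 0; last by rewrite mulr_ge0// ltW.
  by rewrite /h h_le0// normr0 mulr0.
have N0 : 0 <= N by rewrite NE addr_ge0.
have kap0 : 0 <= kap by rewrite !mulr_ge0 ?addr_ge0 ?divr_ge0.
have weak := weak_diff kb wC eps_ge0 pq1 wq1 pq2 wq2.
have den : 0 < 3 * rho + 8 by rewrite addr_gt0// mulr_gt0.
have c0 : 0 <= c by rewrite divr_ge0// ltW.
have c2 : c <= 1 / 2 by exact: ratio_le_half.
have cs : c <= I1 (fun x => x * weight x * S x).
  have -> : I1 (fun x => x * weight x * S x) =
     I1 (fun x => x * weight x * q1 x) + I1 (fun x => x * weight x * q2 x).
    by rewrite -(IntD (Rintegrable_weight_moment (pf_summx pq1))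
      (Rintegrable_weight_moment (pf_summx pq2))); apply: (eq_Int mu) => x;
      rewrite mulrDr.
  have g1 := sigma_ge kb eps_ge0 eps1 rho0 pq1 wq1.
  (* The bound for [q1] suffices, since [q2] contributes a nonnegative amount. *)
  rewrite (le_trans (_ : c <= I1 (fun x => x * weight x * q1 x)))//.
    by rewrite ler_pdivrMr// mulrC.
  rewrite lerDl; apply: Int_ge0 => x; have [xl|xg] := leP x 0.
    by rewrite (pf_le0 pq2)// mulr0.
  by rewrite !mulr_ge0 ?(pf_ge0 pq2)// ltW// weight_gt0.
have mS := measurable_psum pq1 pq2; have mh := measurable_pdiff pq1 pq2.
have mass0 := mass_pdiff pq1 pq2.
have t1 := tail_mass_Int_le mS S_ge0 S_le0 sS sxS mh h_le0 sh sxh mass0 kap0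
  weak c0 c2 cs.
have t2 := pdiff_Int_le S_ge0 S_le0 sS sxS mh h_le0 sh sxh mass0 weak c0 c2 cs.
have Z0 : 0 <= Z.
  by apply: Int_ge0 => x; rewrite mulr_ge0// sqr_ge0.
have N00 : N = 0.
  apply: (smallness_threshold rho0 Z0 c0 _ eps0 small m_le S0_le m_ge0 S0_ge0
    x0 y0 NE erefl t2 t1).
  by rewrite (le_trans c2)// ler_pdivrMr// mul1r ler1n.
have nh0 : I1 (fun x => `|h x|) = 0.
  by apply/eqP; rewrite eq_le x0 andbT -N00 NE lerDl.
apply: (ae_mono (m := mu) (Int_norm_eq0 sh nh0)) => x.
by move/eqP; rewrite subr_eq0 => /eqP.
Qed.

End uniqueness.

Theorem theorem1p11 (R : realType) (W V : R -> R -> R)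
  (hW : sym_kernel W) (hV : sym_kernel V)
  (hW1 : forall x y, 0 < x -> 0 < y -> 0 <= W x y <= 1)
  (hV1 : forall x y, 0 < x -> 0 < y -> 0 <= V x y <= 1 / (x + y))
  (rho : R) (hrho : 0 < rho) :
  exists2 eps_star : R, 0 < eps_star &
    forall eps : R, 0 < eps < eps_star ->
    let K := fun x y => 2 + eps * W x y in
    let F := fun x y => 2 + eps * V x y in
    forall Q1 Q2 : R -> R,
      equilibrium K F Q1 -> mass Q1 = rho ->
      equilibrium K F Q2 -> mass Q2 = rho ->
      {ae lebesgue_measure, forall x : R, 0 < x -> Q1 x = Q2 x}.
Proof.
pose Z := Int lebesgue_measure (@tail_weight R).
(* The first factor bounds [3 / 2 * (1 + m)] with [m <= 4 * rho + 2], the second one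
   [4 + 4 * (3 + int S) * Z] with [int S <= 2 * rho + 2]. *)
pose C := 3 / 2 * (4 * rho + 3) * (4 + 4 * (2 * rho + 5) * Z) + 1.
pose c := rho / (3 * rho + 8).
have Z0 : 0 <= Z by apply: Int_ge0 => x; rewrite mulr_ge0// sqr_ge0.
have C0 : 0 < C.
  by rewrite ltr_wpDl// !mulr_ge0 ?addr_ge0 ?mulr_ge0 ?divr_ge0 ?addr_ge0
    ?mulr_ge0// ltW.
have c0 : 0 < c by rewrite divr_gt0// addr_gt0 ?mulr_gt0.
(* The bound 1 serves the moment estimates, the other one the final absorption. *)
exists (Num.min 1 (c ^+ 2 / C)).
  by rewrite lt_min ltr01 divr_gt0// exprn_gt0.
move=> eps /andP[eps0]; rewrite lt_min => /andP[/ltW eps1].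
rewrite ltr_pdivlMr// => small K F Q1 Q2 [L1 pos1 eq1] mass1 [L2 pos2 eq2]
  mass2.
have eps_ge0 := ltW eps0.
have p1 := profile_equilibrium L1 pos1; rewrite mass1 in p1.
have p2 := profile_equilibrium L2 pos2; rewrite mass2 in p2.
have w1 := weak_solution_equilibrium hW hV hW1 hV1 eps_ge0 L1 pos1 eq1.
have w2 := weak_solution_equilibrium hW hV hW1 hV1 eps_ge0 L2 pos2 eq2.
have kb := kernel_bounds_extend hW hV hW1 hV1.
have uniq := weak_uniqueness kb (coag_kernelC hW) eps0 eps1 hrho p1 w1 p2 w2
  small.
apply: (ae_mono3 (m := lebesgue_measure) pos1 pos2 uniq) => x Q1x Q2x + x0.
have xD : x \in halfline R by rewrite inE.
by rewrite !patchE xD !ger0_norm ?Q1x ?Q2x.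
Qed.
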